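(* Let $U:\mathbb{R}^2\to[0,\infty)$ be an entire stable classical solution of the one-phase free boundary problem in $\mathbb{R}^2$ with $F(U)\ne\emptyset$. Then $U$ is a one-plane or a two-plane solution; that is, up to a rigid motion of $\mathbb{R}^2$, either $U(x_1,x_2)=x_2^+$, or $U(x_1,x_2)=x_2^++(x_2+a)^-$ for some $a>0$.
   Context: Here $t^+=\max\{t,0\}$ and $t^-=\max\{-t,0\}$. For $U:\mathbb{R}^2\to[0,\infty)$, let $\Omega:=\{x\in\mathbb{R}^2:U(x)>0\}$ (positive phase) and $F(U):=\partial\Omega$ (free boundary). The one-phase free boundary problem in $\mathbb{R}^2$ is: $U\ge0$ in $\mathbb{R}^2$, $\Delta U=0$ in $\Omega$, $|\nabla U|=1$ on $F(U)$. A classical solution is a solution $U$ that is continuous, whose free boundary $F(U)$ is a $C^\infty$ hypersurface (here, a curve, not necessarily connected) with $U=0$ on one side and $U>0$ on the other, and such that $U\in C^\infty(\overline{\Omega})$ satisfies $|\nabla U|=1$ on $F(U)$ pointwise, with the gradient evaluated from the positive side. A classical solution $U$ is stable if it is a stable critical point of the functional $J(v)=\int(|\nabla v|^2+1_{\{v>0\}})\,dx$ with respect to compactly supported domain deformations, which for classical solutions takes the form of the stability inequality \[\int_{F(U)}H\phi^2\,d\mathcal{H}^{1}\le\int_{\Omega}|\nabla\phi|^2\,dx\quad\text{for all }\phi\in C_0^\infty(\mathbb{R}^2),\] where $\mathcal{H}^1$ is one-dimensional Hausdorff measure and $H$ is the (mean) curvature of $F(U)$ with respect to the inner unit normal to $\Omega$,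 with sign convention $H=\operatorname{div}(\nabla U/|\nabla U|)$ on $F(U)$ (evaluated from the positive side). *)

(* Defs.v *)
From HB Require Import structures.
From mathcomp Require Import all_boot all_order all_algebra.
From mathcomp Require Import all_classical all_reals all_analysis.

Set Implicit Arguments.
Unset Strict Implicit.
Unset Printing Implicit Defensive.

Import Order.TTheory GRing.Theory Num.Theory.
Import numFieldNormedType.Exports.

Local Open Scope classical_set_scope.
Local Open Scope ring_scope.

(* The canonical norm of the library on [R * R] is the sup norm; it is only
   used for the topology. Lengths are measured with the Euclidean norm. *)
Definition enorm (R : realType) (p : R * R) : R :=
  Num.sqrt (p.1 ^+ 2 + p.2 ^+ 2).

Section Hausdorff1.
Variable R : realType.
Implicit Types A B : set (R * R).
Local Open Scope ereal_scope.

(* 0 is added so that the empty set has diameter 0 rather than -oo. *)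
Definition diam A : \bar R :=
  ereal_sup ([set 0] `|` [set (enorm (x - y))%:E | x in A & y in A]).

Definition diam_cover (delta : R) A : set ((set (R * R))^nat) :=
  [set C | A `<=` \bigcup_k C k /\ forall k, diam (C k) <= delta%:E].

Definition hausdorff1_content (delta : R) A : \bar R :=
  ereal_inf [set \sum_(k <oo) diam (C k) | C in diam_cover delta A].

(* In dimension one the usual normalizing factor is 1. *)
Definition hausdorff1 A : \bar R :=
  ereal_sup [set hausdorff1_content delta A | delta in [set d : R | (0 < d)%R]].

Lemma diam_ge0 A : 0 <= diam A.
Proof. by apply: ereal_sup_ubound; left. Qed.

Lemma diam0 : diam set0 = 0.
Proof.
apply/eqP; rewrite eq_le diam_ge0 andbT; apply: ge_ereal_sup => y [->//|].
by case.
Qed.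

Lemma hausdorff1_content_ge0 delta A : 0 <= hausdorff1_content delta A.
Proof.
apply: le_ereal_inf_tmp => _ [C _ <-].
by apply: nneseries_ge0 => n _ _; exact: diam_ge0.
Qed.

Lemma le_hausdorff1_content delta :
  {homo hausdorff1_content delta : A B / A `<=` B >-> A <= B}.
Proof.
move=> A B AB; apply/ereal_inf_le_tmp => _ [C [BC dC] <-].
by exists C => //; split => //; exact: subset_trans BC.
Qed.

Lemma hausdorff1_content_sigma_subadditive delta :
  sigma_subadditive (hausdorff1_content delta).
Proof.
move=> A.
have [[i ioo]|] := pselect (exists i, hausdorff1_content delta (A i) = +oo).
  rewrite (eseries_pinfty _ _ ioo) ?leey// => n _.
  by rewrite -ltNye (lt_le_trans _ (hausdorff1_content_ge0 _ _)).
rewrite -forallNE => Aoo.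
suff add2e (e : {posnum R}) : hausdorff1_content delta (\bigcup_n A n) <=
    \sum_(i <oo) hausdorff1_content delta (A i) + e%:num%:E.
  by apply/lee_addgt0Pr => _/posnumP[].
rewrite (le_trans _ (epsilon_trick _ _ _))//; last first.
  by move=> n; exact: hausdorff1_content_ge0.
pose P n (B : (set (R * R))^nat) := diam_cover delta (A n) B /\
  \sum_(k <oo) diam (B k) <=
  hausdorff1_content delta (A n) + (e%:num / (2 ^ n.+1)%:R)%:E.
have [G PG] : {G : ((set (R * R))^nat)^nat & forall n, P n (G n)}.
  apply: (@choice _ _ P) => n; rewrite /P /hausdorff1_content.
  set S := (X in ereal_inf X); move infS : (ereal_inf S) => iS.
  case: iS infS => [r Sr|Soo|Soo].
  - have en1 : (0 < e%:num / (2 ^ n.+1)%:R)%R by [].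
    have /(lb_ereal_inf_adherent en1) : ereal_inf S \is a fin_num by rewrite Sr.
    move=> [x [B mB muBx] xS].
    by exists B; split => //; rewrite muBx -Sr; exact/ltW.
  - by have := Aoo n; rewrite /hausdorff1_content Soo.
  - suff : lbound S 0 by move/le_ereal_inf_tmp; rewrite Soo.
    by move=> /= _ [B _ <-]; apply: nneseries_ge0 => k _ _; exact: diam_ge0.
have muG_ge0 x : 0 <= (@diam \o uncurry G) x by exact: diam_ge0.
apply: (@le_trans _ _ (\esum_(i in setT) (@diam \o uncurry G) i)).
  rewrite /hausdorff1_content; apply: ereal_inf_lbound => /=.
  have /card_esym/ppcard_eqP[f] := card_nat2.
  exists (uncurry G \o f).
    split => [|i /=]; last by case: (f i) => a b; exact: (PG a).1.2.
    apply: (@subset_trans _  (\bigcup_n \bigcup_k G n k)) => [t [i _]|].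
      by move=> /((PG i).1.1) -[j _ ?]; exists i => //; exists j.
    move=> t [i _ [j _ Bijt]]; exists (f^-1%FUN (i, j)) => //=.
    by rewrite invK ?inE.
  rewrite -(esum_pred_image (@diam \o uncurry G) _ xpredT) ?[fun=> _]set_true//.
  by rewrite image_eq.
rewrite (_ : esum _ _ = \sum_(i <oo) \sum_(j <oo ) diam (G i j)); last first.
  pose J : nat -> set (nat * nat) := fun i => [set (i, j) | j in setT].
  rewrite (_ : setT = \bigcup_k J k); last first.
    by rewrite predeqE => -[a b]; split => // _; exists a => //; exists b.
  rewrite esum_bigcupT /=; last 2 first.
    - apply/trivIsetP => i j _ _ ij.
      rewrite predeqE => -[n m] /=; split => //= -[] [_] _ [<-{n} _].
      by move=> [m' _] [] /esym/eqP; rewrite (negbTE ij).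
    - by move=> /= [n m]; exact: diam_ge0.
  rewrite -(image_id [set: nat]) -fun_true esum_pred_image//; last first.
    by move=> n _; apply: esum_ge0 => x _; exact: muG_ge0.
  apply: eq_eseriesr => /= j _.
  rewrite -(esum_pred_image (@diam \o uncurry G) (pair j) predT)//=; last 2 first.
    - by move=> n _; exact: diam_ge0.
    - by move=> ? ? _ _; exact: (@can_inj _ _ _ snd).
  by congr esum; rewrite predeqE => -[a b]; split; move=> [i _ <-]; exists i.
apply: lee_lim.
- apply: is_cvg_nneseries => n *.
  by apply: nneseries_ge0 => m *; exact: (muG_ge0 (n, m)).
- apply: is_cvg_nneseries => n *.
  by apply: adde_ge0 => //; exact: hausdorff1_content_ge0.
- by near=> n; apply: lee_sum => i _; exact: (PG i).2.
Unshelve. all: by end_near. Qed.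

Lemma hausdorff1_content_le delta A :
  (0 < delta)%R -> hausdorff1_content delta A <= hausdorff1 A.
Proof. by move=> d0; apply: ereal_sup_ubound; exists delta. Qed.

Lemma hausdorff1_ge0 A : 0 <= hausdorff1 A.
Proof.
exact: le_trans (hausdorff1_content_ge0 1 A) (hausdorff1_content_le A ltr01).
Qed.

Lemma hausdorff1_set0 : hausdorff1 set0 = 0.
Proof.
apply/eqP; rewrite eq_le hausdorff1_ge0 andbT.
apply: ge_ereal_sup => _ [d /= d0 <-]; apply: ereal_inf_lbound.
exists (fun=> set0); first by split => // k; rewrite diam0 lee_fin ltW.
by rewrite eseries0// => k _ _; exact: diam0.
Qed.

Lemma le_hausdorff1 : {homo hausdorff1 : A B / A `<=` B >-> A <= B}.
Proof.
move=> A B AB; apply: ge_ereal_sup => _ [d /= d0 <-].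
exact: le_trans (le_hausdorff1_content d AB) (hausdorff1_content_le B d0).
Qed.

Lemma hausdorff1_sigma_subadditive : sigma_subadditive hausdorff1.
Proof.
move=> A; apply: ge_ereal_sup => _ [d /= d0 <-].
apply: le_trans (hausdorff1_content_sigma_subadditive d A) _.
apply: lee_nneseries => k _; first by move=> _; exact: hausdorff1_content_ge0.
exact: hausdorff1_content_le.
Qed.

HB.instance Definition _ := isOuterMeasure.Build R (R * R)%type hausdorff1
  hausdorff1_set0 hausdorff1_ge0 le_hausdorff1 hausdorff1_sigma_subadditive.

End Hausdorff1.

Definition hausdorff1_outer (R : realType) :
  {outer_measure set (R * R) -> \bar R} := @hausdorff1 R.

(* As a measure, [hausdorff1] lives on its Caratheodory-measurable sets. *)
Definition hausdorff1_measure (R : realType) :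
    {measure set (caratheodory_type (hausdorff1_outer R)) -> \bar R} :=
  hausdorff1_outer R : set (caratheodory_type (hausdorff1_outer R)) -> \bar R.

Definition lebesgue_measure2 (R : realType) :
    {measure set (measurableTypeR R * measurableTypeR R)%type -> \bar R} :=
  (@lebesgue_measure R \x @lebesgue_measure R)%E.

Section Calculus.
Variable R : realType.
Implicit Types (f U : R * R -> R) (D : set (R * R)) (x : R * R).

(* [false] is the first coordinate direction, [true] the second one. *)
Definition basis_vector (i : bool) : R * R := if i then (0, 1) else (1, 0).

Definition partial (i : bool) f : R * R -> R := 'D_(basis_vector i) f.

Definition partials (w : seq bool) f : R * R -> R := foldr partial f w.

Definition gradient f x : R * R := (partial false f x, partial true f x).

Definition divergence (X : R * R -> R * R) x : R :=
  partial false (fst \o X) x + partial true (snd \o X) x.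

Definition laplacian f : R * R -> R := divergence (gradient f).

(* C^oo in the open set [D]. *)
Definition smooth_in D f : Prop := forall (w : seq bool) x, D x ->
  {for x, continuous (partials w f)} /\
  forall i, derivable (partials w f) x (basis_vector i).

(* C^oo in the closure of the open set [D]: all partial derivatives in [D]
   extend continuously to the closure. *)
Definition smooth_closure D f : Prop :=
  smooth_in D f /\
  forall w : seq bool, exists g : R * R -> R,
    {within closure D, continuous g} /\ {in D, partials w f =1 g}.

(* Boundary value at [x] of a function evaluated from the side of [D]. *)
Definition trace D f x : R := lim (f y @[y --> within D (nbhs x)]).

Definition test_function (phi : R * R -> R) : Prop :=
  smooth_in setT phi /\ compact (closure [set x | phi x != 0]).

End Calculus.

Section OnePhase.
Variable R : realType.
Implicit Types (U : R * R -> R) (x : R * R).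

Definition positive_phase U : set (R * R) := [set x | 0 < U x].

Definition free_boundary U : set (R * R) :=
  closure (positive_phase U) `\` (positive_phase U)°.

Definition boundary_gradient U x : R * R :=
  (trace (positive_phase U) (partial false U) x,
   trace (positive_phase U) (partial true U) x).

Definition unit_gradient U x : R * R :=
  (enorm (gradient U x))^-1 *: gradient U x.

Definition curvature U : R * R -> R :=
  trace (positive_phase U) (divergence (unit_gradient U)).

(* Near each of its points, and in suitable orthonormal coordinates (s, t)
   centred at that point, the free boundary is the graph of a C^oo function g,
   with U > 0 above the graph and U = 0 below it. *)
Definition smooth_free_boundary U : Prop :=
  forall p, free_boundary U p ->
  exists (nu : R * R) (delta eps : R) (g : R -> R),
    [/\ enorm nu = 1, 0 < delta, 0 < eps,
        forall n s, `|s| < delta -> derivable (derive1n n g) s 1 &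
        forall s t, `|s| < delta -> `|t| < eps ->
          let q : R * R := p + s *: (nu.2, - nu.1) + t *: nu in
          [/\ free_boundary U q <-> t = g s,
              g s < t -> 0 < U q &
              t < g s -> U q = 0]].

Record classical_solution U : Prop := ClassicalSolution {
  solution_ge0 : forall x, 0 <= U x ;
  solution_continuous : continuous U ;
  solution_free_boundary : smooth_free_boundary U ;
  solution_smooth : smooth_closure (positive_phase U) U ;
  solution_harmonic : forall x, positive_phase U x -> laplacian U x = 0 ;
  solution_gradient : forall x, free_boundary U x ->
    enorm (boundary_gradient U x) = 1 }.

Definition stability_inequality U : Prop :=
  forall phi : R * R -> R, test_function phi ->
  (\int[hausdorff1_measure R]_(x in free_boundary U)
      (curvature U x * phi x ^+ 2)%:E <=
   \int[lebesgue_measure2 R]_(x in positive_phase U)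
      (enorm (gradient phi x) ^+ 2)%:E)%E.

Definition stable_classical_solution U : Prop :=
  classical_solution U /\ stability_inequality U.

Definition rigid_motion (T : R * R -> R * R) : Prop :=
  forall x y, enorm (T x - T y) = enorm (x - y).

Definition pos_part (t : R) : R := Num.max t 0.
Definition neg_part (t : R) : R := Num.max (- t) 0.

End OnePhase.

(* Main.v *)
Require Import Defs.
From HB Require Import structures.
From mathcomp Require Import all_boot all_order all_algebra.
From mathcomp Require Import all_classical all_reals all_analysis.
From mathcomp Require Import measurable_realfun ring lra.

Set Implicit Arguments.
Unset Strict Implicit.
Unset Printing Implicit Defensive.

Import Order.TTheory GRing.Theory Num.Theory.
Import numFieldNormedType.Exports.

Local Open Scope classical_set_scope.
Local Open Scope ring_scope.

(** Write [N = |grad U| ^ 2] and [D] for the positive phase.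

    - [N <= 1] on [D]. The function [log N] is harmonic where [N > 0], so for
      [c > 0] the conformal metric [N / (U + c) ^ 2] has curvature -1. On a
      disk of radius [rho] it is compared with the hyperbolic metric of the disk,
      as in the Ahlfors-Schwarz lemma; the choice [c = rho / 2] makes the
      comparison hold on the free boundary, where [U = 0] and [N = 1]. At the
      centre this reads [|grad U| <= 1 + 2 U / rho], and [rho] is arbitrary
      ([ahlfors_estimate], [gradient_le1]).

    - The curvature of the free boundary is nonnegative. It is minus half of the
      derivative of [N] in the inner normal direction, and [N <= 1 = N] on the
      free boundary ([normal_second_derivative_le0]).

    - Stability forces the curvature to vanish. Logarithmic cutoffs have
      arbitrarily small Dirichlet energy in the plane, while a point of positive
      curvature would contribute a fixed positive amount to the left-hand side of
      the stability inequality ([stable_curvature_eq0]). No integration by parts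
      is involved, but this uses that closed sets are measurable for the
      Hausdorff measure ([closed_caratheodory]) and that an arc of the free
      boundary has positive length ([hausdorff1_projection]).

    - [N = 1] on [D]. Otherwise take the largest disk around a point with
      [N < 1] on which [N < 1] and which is contained in [D]. It touches a point
      where [N = 1] and where the gradient of [N] vanishes: an interior maximum
      of [N], or a point of the free boundary, by the vanishing of the curvature.
      This contradicts Hopf's lemma for the superharmonic function [1 - N]
      ([hopf], [gradient_eq1]).

    - Differentiating [N = 1] shows that the gradient of [U] is locally constant,
      so [D] is a union of half planes on each of which [U] is affine, and there
      is room for at most two disjoint half planes ([one_or_two_planes]). Two
      complementary half planes are excluded because [U] vanishes on one side of
      its free boundary. *)

(** * Directional derivatives in the plane *)

Section DirectionalCalculus.
Variable R : realType.

Lemma is_derive_addf (V : normedModType R) (f g : V -> R) x v a b :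
  is_derive x v f a -> is_derive x v g b ->
  is_derive x v (fun y => f y + g y) (a + b).
Proof. exact: is_deriveD. Qed.

Lemma is_derive_subf (V : normedModType R) (f g : V -> R) x v a b :
  is_derive x v f a -> is_derive x v g b ->
  is_derive x v (fun y => f y - g y) (a - b).
Proof. exact: is_deriveB. Qed.

Lemma is_derive_oppf (V : normedModType R) (f : V -> R) x v a :
  is_derive x v f a -> is_derive x v (fun y => - f y) (- a).
Proof. exact: is_deriveN. Qed.

Lemma is_derive_mulf (V : normedModType R) (f g : V -> R) x v a b :
  is_derive x v f a -> is_derive x v g b ->
  is_derive x v (fun y => f y * g y) (a * g x + f x * b).
Proof.
move=> fa gb; apply: (is_derive_eq (is_deriveM fa gb)).
by rewrite addrC [a * _]mulrC.
Qed.

Lemma is_derive_sqrf (V : normedModType R) (f : V -> R) x v a :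
  is_derive x v f a -> is_derive x v (fun y => f y ^+ 2) (2 * f x * a).
Proof.
move=> fa; under [fun y => _]eq_fun do rewrite expr2.
by apply: (is_derive_eq (is_derive_mulf fa fa)); ring.
Qed.

Lemma is_derive_constf (V : normedModType R) x v (c : R) :
  is_derive x v (fun _ : V => c) 0.
Proof. exact: is_derive_cst. Qed.

Lemma is_derive_affine (V : normedModType R) (f : V -> R) x v c :
  (forall h, f (h *: v + x) = f x + h * c) -> is_derive x v f c.
Proof.
move=> fh.
suff L : (fun h : R => h^-1 *: ((f \o shift x) (h *: v) - f x)) @ 0^' --> c.
  by apply: DeriveDef; [apply/cvg_ex; eexists; exact: L | exact: cvg_lim].
apply/cvgrPdist_lt => e e0; near=> h.
have hn0 : h != 0 by near: h; exact: nbhs_dnbhs_neq.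
by rewrite /= fh addrAC subrr add0r [_ *: _]mulrA mulVf// mul1r subrr normr0.
Unshelve. all: by end_near. Qed.

Lemma is_derive_fstf (x v : R * R) :
  is_derive x v (fun y : R * R => y.1) v.1.
Proof. by apply: is_derive_affine => h; rewrite addrC. Qed.

Lemma is_derive_sndf (x v : R * R) :
  is_derive x v (fun y : R * R => y.2) v.2.
Proof. by apply: is_derive_affine => h; rewrite addrC. Qed.

Lemma is_derive_line (x v : R * R) (f : R * R -> R) d (t : R) : is_derive (x + t *: v) v f d ->
  is_derive t 1 (fun s => f (x + s *: v)) d.
Proof.
have key (s : R) : (fun h : R =>
    h^-1 *: (((fun s => f (x + s *: v)) \o shift s) (h *: (1 : R))
      - f (x + s *: v))) =
  (fun h => h^-1 *: ((f \o shift (x + s *: v)) (h *: v) - f (x + s *: v))).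
  apply/funext => h /=; congr (_ *: (f _ - _)).
  by rewrite [_ *: 1]mulr1 scalerDl addrCA addrA.
move=> [fd <-]; apply: DeriveDef; first by rewrite /derivable key.
by rewrite /derive key.
Qed.

End DirectionalCalculus.

(** [derive_tac] computes a derivative structurally; [derive_eq] leaves the
    equality between the computed and the expected derivative. *)
Ltac derive_tac :=
  repeat first [ eassumption | eapply is_derive_constf | eapply is_derive_addf
    | eapply is_derive_subf | eapply is_derive_oppf | eapply is_derive_sqrf
    | eapply is_derive_mulf | eapply is_derive_fstf | eapply is_derive_sndf ].

Ltac derive_eq := eapply is_derive_eq; [derive_tac | cbv beta].

Section MeanValue.
Variable R : realType.

Lemma MVT_unordered (f df : R -> R) (a b : R) :
  (forall c, `|c - a| <= `|b - a| -> is_derive c 1 f (df c)) ->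
  exists2 c, `|c - a| <= `|b - a| & f b - f a = df c * (b - a).
Proof.
move=> fdf.
have cont (c d : R) : (forall t : R, c <= t <= d -> is_derive t 1 f (df t)) ->
    {within `[c, d], continuous f}.
  move=> H; apply: derivable_within_continuous => t; rewrite in_itv/= => tcd.
  by case: (H t tcd).
have [ab|/ltW ba] := leP a b.
  have D t : a <= t <= b -> is_derive t 1 f (df t).
    by move=> /andP[at_ tb]; apply: fdf; rewrite !ger0_norm ?subr_ge0// lerB.
  have [|c cab ->] := MVT_segment (df := df) ab _ (cont _ _ D).
    by move=> t; rewrite in_itv/= => /andP[/ltW at_ /ltW tb]; apply: D; rewrite at_.
  exists c => //; move: cab; rewrite in_itv/= => /andP[ac cb].
  by rewrite !ger0_norm ?subr_ge0// lerB.
have D t : b <= t <= a -> is_derive t 1 f (df t).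
  move=> /andP[at_ tb]; apply: fdf; rewrite distrC (distrC b).
  by rewrite !ger0_norm ?subr_ge0// lerB.
have [|c cab E] := MVT_segment (df := df) ba _ (cont _ _ D).
  by move=> t; rewrite in_itv/= => /andP[/ltW at_ /ltW tb]; apply: D; rewrite at_.
exists c; last by rewrite -opprB E; ring.
move: cab; rewrite in_itv/= => /andP[ac cb].
by rewrite distrC (distrC b) !ger0_norm ?subr_ge0// lerB.
Qed.

End MeanValue.

Section C1.
Variable R : realType.
Implicit Types (f : R * R -> R) (x v : R * R).
Let e1 : R * R := basis_vector R false.
Let e2 : R * R := basis_vector R true.

Lemma near_square x (P : set (R * R)) : (\forall y \near x, P y) ->
  exists2 d : R, 0 < d &
    forall y, `|y.1 - x.1| < d -> `|y.2 - x.2| < d -> P y.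
Proof.
move=> /nbhs_ballP[d /= d0 xP]; exists d => // y y1 y2; apply: xP.
by split; rewrite /ball/= distrC.
Qed.

Lemma continuous_square f x : {for x, continuous f} ->
  forall e : R, 0 < e -> exists2 d : R, 0 < d &
    forall y, `|y.1 - x.1| < d -> `|y.2 - x.2| < d -> `|f y - f x| < e.
Proof.
move=> /cvgrPdist_lt fx e e0; apply: near_square.
by near=> y; rewrite distrC; near: y; exact: fx.
Unshelve. all: by end_near. Qed.

Lemma is_derive_slice1 f (c y d : R) : is_derive (c, y) e1 f d ->
  is_derive c 1 (fun t => f (t, y)) d.
Proof.
have E t : (t, y) = ((0, y) + t *: e1 : R * R).
  by rewrite /e1/=; congr pair; rewrite /=; [rewrite add0r [_ *: _]mulr1|rewrite scaler0 addr0].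
by move=> H; under eq_fun do rewrite E; apply: is_derive_line; rewrite -E.
Qed.

Lemma is_derive_slice2 f (c y d : R) : is_derive (y, c) e2 f d ->
  is_derive c 1 (fun t => f (y, t)) d.
Proof.
have E t : (y, t) = ((y, 0) + t *: e2 : R * R).
  by rewrite /e2/=; congr pair; rewrite /=; [rewrite scaler0 addr0|rewrite add0r [_ *: _]mulr1].
by move=> H; under eq_fun do rewrite E; apply: is_derive_line; rewrite -E.
Qed.

Lemma MVT_fst f df (a b y : R) :
  (forall c, `|c - a| <= `|b - a| -> is_derive (c, y) e1 f (df (c, y))) ->
  exists2 c, `|c - a| <= `|b - a| & f (b, y) - f (a, y) = df (c, y) * (b - a).
Proof.
move=> fdf; apply: (MVT_unordered (f := fun t => f (t, y)) (df := fun t => df (t, y))).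
by move=> c /fdf; exact: is_derive_slice1.
Qed.

Lemma MVT_snd f df (a b y : R) :
  (forall c, `|c - a| <= `|b - a| -> is_derive (y, c) e2 f (df (y, c))) ->
  exists2 c, `|c - a| <= `|b - a| & f (y, b) - f (y, a) = df (y, c) * (b - a).
Proof.
move=> fdf; apply: (MVT_unordered (f := fun t => f (y, t)) (df := fun t => df (y, t))).
by move=> c /fdf; exact: is_derive_slice2.
Qed.

(** The increment of [f] along [v] is split into two increments parallel to the
    axes, and the mean value theorem is applied to each. *)
Lemma C1_is_derive f d1 d2 x v :
  (\forall y \near x, is_derive y e1 f (d1 y) /\ is_derive y e2 f (d2 y)) ->
  {for x, continuous d1} -> {for x, continuous d2} ->
  is_derive x v f (v.1 * d1 x + v.2 * d2 x).
Proof.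
move=> /near_square[d d0 fd] c1 c2.
suff L : (fun h : R => h^-1 *: ((f \o shift x) (h *: v) - f x)) @ 0^' -->
    v.1 * d1 x + v.2 * d2 x.
  by apply: DeriveDef; [apply/cvg_ex; eexists; exact: L | exact: cvg_lim].
apply/cvgrPdist_lt => e e0.
set m := 1 + `|v.1| + `|v.2|.
have m0 : 0 < m by rewrite /m -addrA ltr_pwDl// addr_ge0.
have [da da0 Ha] := continuous_square c1 (divr_gt0 e0 m0).
have [db db0 Hb] := continuous_square c2 (divr_gt0 e0 m0).
pose k := Num.min d (Num.min da db).
have k0 : 0 < k by rewrite !lt_min d0 da0 db0.
have km0 : 0 < k / m by rewrite divr_gt0.
near=> h.
have hn0 : h != 0 by near: h; exact: nbhs_dnbhs_neq.
have hk : `|h| < k / m by near: h; exact: dnbhs0_lt.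
have hv i : `|i| <= m -> `|h * i| < k.
  move=> im; rewrite normrM (le_lt_trans (ler_wpM2l _ im))//.
  by rewrite -ltr_pdivlMr.
have hv1 : `|h * v.1| < k by apply: hv; rewrite /m addrAC lerDr addr_ge0.
have hv2 : `|h * v.2| < k by apply: hv; rewrite /m lerDr addr_ge0.
have kd : k <= d by rewrite ge_min lexx.
have kda : k <= da by rewrite !ge_min lexx orbT.
have kdb : k <= db by rewrite !ge_min lexx !orbT.
have sx1 : `|h * v.1 + x.1 - x.1| < d by rewrite addrK (lt_le_trans hv1).
have sx2 : `|h * v.2 + x.2 - x.2| < d by rewrite addrK (lt_le_trans hv2).
have sx0 : `|x.1 - x.1| < d by rewrite subrr normr0.
have [|a aa Ea] := MVT_fst (f := f) (df := d1) (a := x.1) (b := h * v.1 + x.1)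
    (y := h * v.2 + x.2).
  by move=> c cx; have [] := fd (c, h * v.2 + x.2) (le_lt_trans cx sx1) sx2.
have [|b bb Eb] := MVT_snd (f := f) (df := d2) (a := x.2) (b := h * v.2 + x.2)
    (y := x.1).
  by move=> c cx; have [] := fd (x.1, c) sx0 (le_lt_trans cx sx2).
have -> : (f \o shift x) (h *: v) - f x = h * (v.1 * d1 (a, h * v.2 + x.2) + v.2 * d2 (x.1, b)).
  rewrite /=.
  have -> : h *: v + x = (h * v.1 + x.1, h * v.2 + x.2) by [].
  rewrite [in f x](surjective_pairing x).
  move: Ea Eb; rewrite !addrK => Ea Eb.
  rewrite (_ : f _ - f _ =
    (f (h * v.1 + x.1, h * v.2 + x.2) - f (x.1, h * v.2 + x.2))
    + (f (x.1, h * v.2 + x.2) - f (x.1, x.2))); last by ring.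
  by rewrite Ea Eb; ring.
rewrite [_ *: _]mulrA mulVf// mul1r.
have {}aa : `|d1 (a, h * v.2 + x.2) - d1 x| < e / m.
  apply: Ha; first by rewrite (le_lt_trans aa)// addrK (lt_le_trans hv1).
  by rewrite /= addrK (lt_le_trans hv2).
have {}bb : `|d2 (x.1, b) - d2 x| < e / m.
  apply: Hb; first by rewrite /= subrr normr0.
  by rewrite (le_lt_trans bb)// addrK (lt_le_trans hv2).
have -> : v.1 * d1 x + v.2 * d2 x - (v.1 * d1 (a, h * v.2 + x.2) + v.2 * d2 (x.1, b)) =
  - (v.1 * (d1 (a, h * v.2 + x.2) - d1 x) + v.2 * (d2 (x.1, b) - d2 x)) by ring.
rewrite normrN (le_lt_trans (ler_normD _ _))// !normrM.
have em0 : 0 < e / m by rewrite divr_gt0.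
have : `|v.1| * `|d1 (a, h * v.2 + x.2) - d1 x| <= `|v.1| * (e / m) by rewrite ler_wpM2l// ltW.
have : `|v.2| * `|d2 (x.1, b) - d2 x| <= `|v.2| * (e / m) by rewrite ler_wpM2l// ltW.
have : e = e / m + `|v.1| * (e / m) + `|v.2| * (e / m).
  by rewrite -[X in X + _ + _]mul1r -!mulrDl -/m mulrCA divff ?mulr1// gt_eqF.
lra.
Unshelve. all: by end_near. Qed.

(** The second difference of [f] over a small square is, by the mean value
    theorem applied twice, a value of either mixed derivative, depending on which
    coordinate is treated first. *)
Lemma mixed_partials_eq f f1 f2 f12 f21 x :
  (\forall y \near x, [/\ is_derive y e1 f (f1 y), is_derive y e2 f (f2 y),
     is_derive y e2 f1 (f12 y) & is_derive y e1 f2 (f21 y)]) ->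
  {for x, continuous f12} -> {for x, continuous f21} -> f12 x = f21 x.
Proof.
move=> /near_square[d d0 fd] c1 c2.
apply/eqP; rewrite -subr_eq0 -normr_le0; apply/ler_addgt0Pr => e e0; rewrite add0r.
have e20 : 0 < e / 2 by lra.
have [da da0 Ha] := continuous_square c1 e20.
have [db db0 Hb] := continuous_square c2 e20.
pose k := Num.min d (Num.min da db).
have k0 : 0 < k by rewrite !lt_min d0 da0 db0.
have kd : k <= d by rewrite ge_min lexx.
have kda : k <= da by rewrite !ge_min lexx orbT.
have kdb : k <= db by rewrite !ge_min lexx !orbT.
have [h h0 hk] : exists2 h : R, 0 < h & h < k by exists (k / 2); lra.
have lth (u w : R) : `|u - w| <= `|w + h - w| -> `|u - w| < k.
  by move=> /le_lt_trans; apply; rewrite addrAC subrr add0r gtr0_norm.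
have lthd (u w : R) : `|u - w| <= `|w + h - w| -> `|u - w| < d.
  by move=> /lth /lt_le_trans; apply.
have hd (w : R) : `|w + h - w| < d.
  by rewrite addrAC subrr add0r gtr0_norm// (lt_le_trans hk).
have zd (w : R) : `|w - w| < d by rewrite subrr normr0.
have [|a aa Ea] := MVT_unordered
  (f := fun s => f (s, x.2 + h) - f (s, x.2))
  (df := fun s => f1 (s, x.2 + h) - f1 (s, x.2)) (a := x.1) (b := x.1 + h).
  move=> c /lthd cx; apply: is_derive_subf; apply: is_derive_slice1.
    by have [] := fd (c, x.2 + h) cx (hd _).
  by have [] := fd (c, x.2) cx (zd _).
have [|a' aa' Ea'] := MVT_snd (f := f1) (df := f12) (a := x.2) (b := x.2 + h) (y := a).
  by move=> c /lthd cx; have [] := fd (a, c) (lthd _ _ aa) cx.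
have [|b bb Eb] := MVT_unordered
  (f := fun s => f (x.1 + h, s) - f (x.1, s))
  (df := fun s => f2 (x.1 + h, s) - f2 (x.1, s)) (a := x.2) (b := x.2 + h).
  move=> c /lthd cx; apply: is_derive_subf; apply: is_derive_slice2.
    by have [] := fd (x.1 + h, c) (hd _) cx.
  by have [] := fd (x.1, c) (zd _) cx.
have [|b' bb' Eb'] := MVT_fst (f := f2) (df := f21) (a := x.1) (b := x.1 + h) (y := b).
  by move=> c /lthd cx; have [] := fd (c, b) cx (lthd _ _ bb).
have E : f12 (a, a') = f21 (b', b).
  have h2 : h * h != 0 by rewrite mulf_neq0 ?gt_eqF.
  apply: (mulIf h2); move: Ea Eb; rewrite Ea' Eb'.
  have hh (u : R) : u + h - u = h by rewrite addrAC subrr add0r.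
  by rewrite !hh -!mulrA => Ea Eb; rewrite -Ea -Eb; ring.
have Pa := Ha (a, a') (lt_le_trans (lth _ _ aa) kda) (lt_le_trans (lth _ _ aa') kda).
have Pb := Hb (b', b) (lt_le_trans (lth _ _ bb') kdb) (lt_le_trans (lth _ _ bb) kdb).
have -> : f12 x - f21 x = (f21 (b', b) - f21 x) - (f12 (a, a') - f12 x) by rewrite E; ring.
by rewrite (le_trans (ler_normB _ _))// [leRHS]splitr lerD// ltW.
Qed.

Lemma is_derive_small (V : normedModType R) (f : V -> R) (x v : V) l :
  is_derive x v f l -> forall e : R, 0 < e -> exists2 d : R, 0 < d &
    forall s, `|s| < d -> `|f (x + s *: v) - f x - s * l| <= e * `|s|.
Proof.
move=> [/[swap] <- fl] e e0.
have /cvgrPdist_le/(_ _ e0) :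
    (fun h => h^-1 *: ((f \o shift x) (h *: v) - f x)) @ 0^' --> 'D_v f x.
  exact: fl.
move=> /nbhs_ballP[d /= d0 dP]; exists d => // s sd.
have [->|s0] := eqVneq s 0; first by rewrite scale0r addr0 mul0r !subrr normr0 mulr0.
have := dP s; rewrite /ball/= sub0r normrN => /(_ sd s0).
rewrite distrC -(ler_pM2r (_ : 0 < `|s|)) ?normr_gt0// -normrM mulrBl.
rewrite [_ *: _ * _]mulrAC mulVf// mul1r [x + _]addrC.
by rewrite [s * _]mulrC.
Qed.

(** If [d2] were positive, the derivative, which vanishes at [x], would be
    positive just after [x], and [f] would increase there. *)
Lemma local_max_derive f (d : R * R -> R) x v (d2 : R) :
  (\forall y \near x, is_derive y v f (d y)) -> is_derive x v d d2 ->
  (\forall y \near x, f y <= f x) -> d x = 0 /\ d2 <= 0.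
Proof.
move=> fd dd2 fx.
pose h (t : R) : R := f (x + t *: v); pose dh (t : R) : R := d (x + t *: v).
have lc : (fun t : R => x + t *: v) @ 0 --> x.
  suff : (fun t : R => x + t *: v) @ 0 --> x + 0 *: v by rewrite scale0r addr0.
  by apply: cvgD; [exact: cvg_cst | apply: cvgZr_tmp; exact: cvg_id].
have near0 P : (\forall y \near x, P y) ->
    exists2 r : R, 0 < r & forall t : R, `|t| < r -> P (x + t *: v).
  move=> /lc; rewrite nbhs_filterE /= => /nbhs_ballP[r r0 rP]; exists r => // t tr.
  by apply: rP; rewrite /ball/= sub0r normrN.
have [r r0 fdr] := near0 _ (filterI fd fx).
have hd (t : R) : `|t| < r -> is_derive t 1 h (dh t).
  by move=> /fdr[+ _]; exact: is_derive_line.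
have hmax (t : R) : `|t| < r -> h t <= h 0.
  by move=> /fdr[_ +]; rewrite /h scale0r addr0.
have itvr (t : R) : t \in `]-r, r[%R -> `|t| < r by rewrite in_itv/= ltr_norml.
have h0 : is_derive (0:R) 1 h 0.
  apply: (@derive1_at_max _ h (-r) r 0).
  - by lra.
  - by move=> t /itvr /hd[].
  - by rewrite in_itv/=; lra.
  - by move=> t /itvr /hmax.
have dh0 : dh 0 = 0.
  have r0' : `|0 : R| < r by rewrite normr0.
  by have [_ <-] := hd 0 r0'; have [_ ->] := h0.
split; first by move: dh0; rewrite /dh scale0r addr0.
rewrite leNgt; apply/negP => d2p.
have hd2 : is_derive (0:R) 1 dh d2 by apply: is_derive_line; rewrite scale0r addr0.
have [s s0 sP] := is_derive_small hd2 (divr_gt0 d2p (ltr0Sn R 1)).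
pose t := Num.min r s / 2.
have m0 : 0 < Num.min r s by rewrite lt_min r0.
have t0 : 0 < t by rewrite /t divr_gt0.
have tm : t < Num.min r s by rewrite /t; lra.
have tr : t < r by rewrite (lt_le_trans tm)// ge_min lexx.
have ts : t < s by rewrite (lt_le_trans tm)// ge_min lexx orbT.
have [||c] := MVT (f := h) (df := dh) t0.
- move=> u; rewrite in_itv/= => /andP[u0 ut]; apply: hd.
  by rewrite gtr0_norm// (lt_trans ut).
- apply: derivable_within_continuous => u; rewrite in_itv/= => /andP[u0 ut].
  suff : is_derive u 1 h (dh u) by case.
  by apply: hd; rewrite ger0_norm// (le_lt_trans ut).
rewrite in_itv/= => /andP[c0 ct]; rewrite subr0 => E.
have ht : h t <= h 0 by apply: hmax; rewrite gtr0_norm.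
have := sP c; rewrite gtr0_norm// => /(_ (lt_trans ct ts)).
rewrite add0r [c *: 1]mulr1 dh0 subr0 ler_norml => /andP[+ _].
have : dh c * t <= 0 by rewrite -E subr_le0.
rewrite pmulr_lle0// => dc0.
have := mulr_gt0 c0 d2p.
lra.
Qed.

End C1.

Section ChainRule.
Variable R : realType.

Lemma is_derive_chain (V : normedModType R) (f : V -> R) (g : R -> R)
    (x v : V) a b : is_derive x v f a -> is_derive (f x) 1 g b ->
  is_derive x v (fun y => g (f y)) (b * a).
Proof.
move=> fa gb; pose h t := f (t *: v + x).
have E (k : V -> R) : (fun t : R =>
    t^-1 *: (((fun t => k (t *: v + x)) \o shift 0) (t *: (1 : R))
      - k (0 *: v + x))) =
    (fun t => t^-1 *: ((k \o shift x) (t *: v) - k x)).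
  by apply/funext => t /=; rewrite addr0 scale0r add0r [t *: 1]mulr1.
have ha : is_derive (0 : R) 1 h a.
  have [/derivable1P fd <-] := fa; apply: DeriveDef => //.
  by rewrite /derive E.
have h0 : h 0 = f x by rewrite /h scale0r add0r.
have gh : is_derive (0 : R) 1 (g \o h) (b * a).
  have gd : derivable g (h 0) 1 by rewrite h0; case: gb.
  have hd : derivable h 0 1 by case: ha.
  apply: DeriveDef.
    apply/derivable1_diffP.
    by apply: differentiable_comp; apply/derivable1_diffP.
  rewrite -derive1E derive1_comp// !derive1E h0.
  by have [_ ->] := gb; have [_ ->] := ha.
have [ghd <-] := gh; apply: DeriveDef; first exact/derivable1P.
by rewrite /derive -(E (fun y => g (f y))).
Qed.

Lemma is_derive_invf (V : normedModType R) (f : V -> R) (x v : V) a :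
  f x != 0 -> is_derive x v f a ->
  is_derive x v (fun y => (f y)^-1) (- (f x)^-1 ^+ 2 * a).
Proof.
move=> fx0 [fd <-]; apply: DeriveDef; first exact: derivableV.
by rewrite deriveV// exprVn.
Qed.

Lemma is_derive_sqrtf (V : normedModType R) (f : V -> R) (x v : V) a :
  0 < f x -> is_derive x v f a ->
  is_derive x v (fun y => Num.sqrt (f y)) ((2 * Num.sqrt (f x))^-1 * a).
Proof. by move=> f0 fa; apply: is_derive_chain => //; exact: is_derive1_sqrt. Qed.

End ChainRule.

(** * Plane geometry and compactness *)

Section Plane.
Variable R : realType.
Implicit Types (f : R * R -> R) (x y : R * R) (A D : set (R * R)).

Definition sqdist x y : R := (y.1 - x.1) ^+ 2 + (y.2 - x.2) ^+ 2.

Lemma sqdist_ge0 x y : 0 <= sqdist x y.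
Proof. by rewrite addr_ge0// sqr_ge0. Qed.

Lemma sqdistxx x : sqdist x x = 0.
Proof. by rewrite /sqdist !subrr expr0n addr0. Qed.

Lemma enorm_ge0 x : 0 <= enorm x. Proof. exact: sqrtr_ge0. Qed.

Lemma enorm_sqr x : enorm x ^+ 2 = x.1 ^+ 2 + x.2 ^+ 2.
Proof. by rewrite sqr_sqrtr// addr_ge0// sqr_ge0. Qed.

Lemma fst_continuous : continuous (fun y : R * R => y.1).
Proof. by move=> y; exact: cvg_fst. Qed.

Lemma snd_continuous : continuous (fun y : R * R => y.2).
Proof. by move=> y; exact: cvg_snd. Qed.

Lemma sqdist_continuous x : continuous (sqdist x).
Proof.
move=> y; apply: cvgD; rewrite ?expr2; under eq_fun do rewrite expr2; apply: cvgM;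
  apply: cvgB; by [exact: fst_continuous | exact: snd_continuous | exact: cvg_cst].
Qed.

Lemma sqdist_coord x y (d : R) : 0 <= d -> sqdist x y <= d ^+ 2 ->
  `|y.1 - x.1| <= d /\ `|y.2 - x.2| <= d.
Proof.
move=> d0 h; split; rewrite -[leRHS]ger0_norm// -ler_sqr ?nnegrE// !real_normK ?num_real//.
  by apply: le_trans h; rewrite lerDl sqr_ge0.
by apply: le_trans h; rewrite lerDr sqr_ge0.
Qed.

Lemma compact_disk A x (d : R) : 0 <= d -> closed A ->
  compact (A `&` [set y | sqdist x y <= d ^+ 2]).
Proof.
move=> d0 cA; apply: (@subclosed_compact _ _
  (`[x.1 - d, x.1 + d]%classic `*` `[x.2 - d, x.2 + d]%classic)).
- apply: closedI => //.
  rewrite (_ : [set y | _] = sqdist x @^-1` [set t | t <= d ^+ 2])//.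
  by apply: closed_comp => [y _|]; [exact: sqdist_continuous|exact: closed_le].
- by apply: compact_setX; exact: segment_compact.
- move=> y [_ /= /(sqdist_coord d0)[]]; rewrite !ler_norml => /andP[a b] /andP[a' b'].
  by split; rewrite /= in_itv/=; apply/andP; split; lra.
Qed.

Lemma within_closure_continuous D f x : open D ->
  {within closure D, continuous f} -> D x -> {for x, continuous f}.
Proof.
move=> oD cf Dx; have : {within D, continuous f}.
  by apply: continuous_subspaceW cf; exact: subset_closure.
by rewrite continuous_open_subspace// => /(_ x); apply; rewrite inE.
Qed.

End Plane.

Section EuclideanNorm.
Variable R : realType.

Lemma enorm_triangle (x y : R * R) : enorm (x + y) <= enorm x + enorm y.
Proof.
rewrite -(@ler_pXn2r _ 2)// ?nnegrE ?addr_ge0 ?enorm_ge0//.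
rewrite sqrrD !enorm_sqr /=.
have cs : x.1 * y.1 + x.2 * y.2 <= enorm x * enorm y.
  apply: le_trans (ler_norm _) _.
  rewrite -(@ler_pXn2r _ 2)// ?nnegrE ?mulr_ge0 ?enorm_ge0//.
  rewrite real_normK ?num_real// exprMn !enorm_sqr.
  rewrite -subr_ge0 (_ : _ - _ = (x.1 * y.2 - x.2 * y.1) ^+ 2) ?sqr_ge0//.
  by ring.
by rewrite -mulr_natr; lra.
Qed.

Lemma enormN (x : R * R) : enorm (- x) = enorm x.
Proof. by rewrite /enorm /= !sqrrN. Qed.

Lemma enorm_coord (x t : R * R) : enorm t = 1 ->
  `|x.1 * t.1 + x.2 * t.2| <= enorm x.
Proof.
move=> t1; rewrite -(@ler_pXn2r _ 2)// ?nnegrE ?enorm_ge0//.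
rewrite real_normK ?num_real// enorm_sqr.
have t2 : t.1 ^+ 2 + t.2 ^+ 2 = 1 by rewrite -enorm_sqr t1 expr1n.
rewrite -subr_ge0 -[X in 0 <= X - _]mulr1 -t2.
by rewrite (_ : _ - _ = (x.1 * t.2 - x.2 * t.1) ^+ 2) ?sqr_ge0//; ring.
Qed.

End EuclideanNorm.

(** * Harmonic functions with gradient of length one on the boundary *)

Section Jet.
Variable R : realType.
Let e1 : R * R := basis_vector R false.
Let e2 : R * R := basis_vector R true.

(** The derivatives up to order three of a harmonic function [u]: since
    [p - iq] is holomorphic, each order only involves two functions. Up to order
    two they stand for the extensions to the closure of [D]. *)
Record harmonic_jet (D : set (R * R)) (u p q r s a b : R * R -> R) : Prop :=
  HarmonicJet {
  jet_open : open D ;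
  jet_u1 : forall x, D x -> is_derive x e1 u (p x) ;
  jet_u2 : forall x, D x -> is_derive x e2 u (q x) ;
  jet_p1 : forall x, D x -> is_derive x e1 p (r x) ;
  jet_p2 : forall x, D x -> is_derive x e2 p (s x) ;
  jet_q1 : forall x, D x -> is_derive x e1 q (s x) ;
  jet_q2 : forall x, D x -> is_derive x e2 q (- r x) ;
  jet_r1 : forall x, D x -> is_derive x e1 r (a x) ;
  jet_r2 : forall x, D x -> is_derive x e2 r (b x) ;
  jet_s1 : forall x, D x -> is_derive x e1 s (b x) ;
  jet_s2 : forall x, D x -> is_derive x e2 s (- a x) ;
  jet_cu : {within closure D, continuous u} ;
  jet_cp : {within closure D, continuous p} ;
  jet_cq : {within closure D, continuous q} ;
  jet_cr : {within closure D, continuous r} ;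
  jet_cs : {within closure D, continuous s} }.

(** The computation at an interior maximum. The logarithm of
    [N * phi ^ 2 / w ^ 2] is avoided: if [M] is the maximum, the polynomial
    expression [N * phi ^ 2 - M * w ^ 2] has a local maximum with value [0], so
    its gradient vanishes and its Laplacian, the left-hand side of the last
    hypothesis, is nonpositive. The key identity is
    [Nx ^ 2 + Ny ^ 2 = 4 * (r ^ 2 + s ^ 2) * N], the harmonicity of [log N]. *)
Lemma ahlfors_algebra (p q r s X Y rho w M : R) :
  let N := p ^+ 2 + q ^+ 2 in
  let phi := rho ^+ 2 - (X ^+ 2 + Y ^+ 2) in
  let Nx := 2 * (p * r + q * s) in let Ny := 2 * (p * s - q * r) in
  0 < N -> 0 < phi -> N * phi ^+ 2 = M * w ^+ 2 ->
  Nx * phi ^+ 2 - 4 * N * phi * X - 2 * M * w * p = 0 ->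
  Ny * phi ^+ 2 - 4 * N * phi * Y - 2 * M * w * q = 0 ->
  4 * (r ^+ 2 + s ^+ 2) * phi ^+ 2 - 8 * phi * (X * Nx + Y * Ny)
    + 8 * N * (X ^+ 2 + Y ^+ 2 - phi) - 2 * M * N <= 0 ->
  M <= 4 * rho ^+ 2.
Proof.
move=> N phi Nx Ny N0 phi0 E Ex Ey L.
have Ax : Nx * phi ^+ 2 = 4 * N * phi * X + 2 * M * w * p by lra.
have Ay : Ny * phi ^+ 2 = 4 * N * phi * Y + 2 * M * w * q by lra.
set S := X ^+ 2 + Y ^+ 2 in phi phi0 E Ex Ey L Ax Ay *.
set LL := (X in X <= 0) in L.
(* The first order conditions [Ax] and [Ay] eliminate [Nx] and [Ny]. *)
have K : LL * (N * phi ^+ 2) = 2 * N ^+ 2 * phi ^+ 2 * (M - 4 * rho ^+ 2).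
  have I1 : 4 * (r ^+ 2 + s ^+ 2) * phi ^+ 2 * (N * phi ^+ 2) =
      (Nx * phi ^+ 2) ^+ 2 + (Ny * phi ^+ 2) ^+ 2.
    by rewrite /Nx /Ny /N; ring.
  have I2 : 8 * phi * (X * Nx + Y * Ny) * (N * phi ^+ 2) =
      8 * phi * N * (X * (Nx * phi ^+ 2) + Y * (Ny * phi ^+ 2)) by ring.
  rewrite /LL mulrBl mulrDl mulrBl I1 I2 Ax Ay.
  have -> : (4 * N * phi * X + 2 * M * w * p) ^+ 2 + (4 * N * phi * Y + 2 * M * w * q) ^+ 2
    = 16 * N ^+ 2 * phi ^+ 2 * S + 16 * N * phi * M * w * (X * p + Y * q)
      + 4 * M * (M * w ^+ 2) * N by rewrite /N /S; ring.
  by rewrite -E /phi /S; ring.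
have P0 : 0 < N * phi ^+ 2 by rewrite mulr_gt0// exprn_gt0.
have : LL * (N * phi ^+ 2) <= 0 by rewrite pmulr_lle0.
rewrite K pmulr_rle0; first by rewrite subr_le0.
by rewrite !mulr_gt0// exprn_gt0.
Qed.

Section Estimate.
Variables (D : set (R * R)) (u p q r s a b : R * R -> R).
Hypothesis J : harmonic_jet D u p q r s a b.
Hypothesis u_ge0 : forall x, 0 <= u x.
Hypothesis bdry : forall x, closure D x -> ~ D x ->
  u x = 0 /\ p x ^+ 2 + q x ^+ 2 = 1.

Let N x := p x ^+ 2 + q x ^+ 2.

Lemma jet_near x (P : set (R * R)) : D x -> (forall y, D y -> P y) ->
  \forall y \near x, P y.
Proof.
move=> Dx DP; apply: filterS DP _.
exact: (open_nbhs_nbhs (conj (jet_open J) Dx)).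
Qed.

Lemma within_sqnorm_gradient : {within closure D, continuous N}.
Proof.
move=> x; rewrite /N; under eq_fun do rewrite !expr2.
by apply: cvgD; apply: cvgM; by [exact: (jet_cp J)|exact: (jet_cq J)].
Qed.

Section InteriorMax.
Variables (x0 c : R * R) (rho M : R).
Hypothesis Dc : D c.
Let phi y := rho ^+ 2 - sqdist x0 y.
Let w y := u y + rho / 2.
Hypotheses (phi0 : 0 < phi c) (N0 : 0 < N c).
Hypothesis EM : N c * phi c ^+ 2 = M * w c ^+ 2.
Hypothesis maxM : \forall y \near c, N y * phi y ^+ 2 - M * w y ^+ 2 <= 0.

Let Psi y := N y * phi y ^+ 2 - M * w y ^+ 2.

Let phi1 y : is_derive y e1 phi (- (2 * (y.1 - x0.1))).
Proof.
rewrite /phi /sqdist; derive_eq.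
by rewrite /e1/=; ring.
Qed.

Let phi2 y : is_derive y e2 phi (- (2 * (y.2 - x0.2))).
Proof.
rewrite /phi /sqdist; derive_eq.
by rewrite /e2/=; ring.
Qed.

(** In the sum of the two second derivatives the third derivatives of [u]
    cancel, by harmonicity. *)
Lemma ahlfors_interior : M <= 4 * rho ^+ 2.
Proof.
have maxP : \forall y \near c, Psi y <= Psi c.
  have Pc : Psi c = 0 by rewrite /Psi EM subrr.
  by apply: filterS maxM => y; rewrite Pc.
pose Psi1 y := 2 * (p y * r y + q y * s y) * phi y ^+ 2
  - 4 * N y * phi y * (y.1 - x0.1) - 2 * M * w y * p y.
pose Psi2 y := 2 * (p y * s y - q y * r y) * phi y ^+ 2
  - 4 * N y * phi y * (y.2 - x0.2) - 2 * M * w y * q y.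
have d1 y : D y -> is_derive y e1 Psi (Psi1 y).
  move=> Dy; have := phi1 y; have := jet_p1 J Dy; have := jet_q1 J Dy; have := jet_u1 J Dy.
  move=> *; rewrite /Psi /N /w; derive_eq.
  by rewrite /Psi1 /N /w; ring.
have d2 y : D y -> is_derive y e2 Psi (Psi2 y).
  move=> Dy; have := phi2 y; have := jet_p2 J Dy; have := jet_q2 J Dy; have := jet_u2 J Dy.
  move=> *; rewrite /Psi /N /w; derive_eq.
  by rewrite /Psi2 /N /w; ring.
pose l1 := 2 * (r c ^+ 2 + s c ^+ 2 + p c * a c + q c * b c) * phi c ^+ 2
  - 8 * phi c * (c.1 - x0.1) * (2 * (p c * r c + q c * s c))
  + 8 * N c * (c.1 - x0.1) ^+ 2 - 4 * N c * phi c
  - 2 * M * (p c ^+ 2 + w c * r c).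
pose l2 := 2 * (r c ^+ 2 + s c ^+ 2 - p c * a c - q c * b c) * phi c ^+ 2
  - 8 * phi c * (c.2 - x0.2) * (2 * (p c * s c - q c * r c))
  + 8 * N c * (c.2 - x0.2) ^+ 2 - 4 * N c * phi c
  - 2 * M * (q c ^+ 2 - w c * r c).
have d11 : is_derive c e1 Psi1 l1.
  have := phi1 c; have := jet_p1 J Dc; have := jet_q1 J Dc; have := jet_u1 J Dc.
  have := jet_r1 J Dc; have := jet_s1 J Dc.
  move=> *; rewrite /Psi1 /N /w; derive_eq.
  by rewrite /l1 /N /w /e1/=; ring.
have d22 : is_derive c e2 Psi2 l2.
  have := phi2 c; have := jet_p2 J Dc; have := jet_q2 J Dc; have := jet_u2 J Dc.
  have := jet_r2 J Dc; have := jet_s2 J Dc.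
  move=> *; rewrite /Psi2 /N /w; derive_eq.
  by rewrite /l2 /N /w /e2/=; ring.
have [z1 n1] := local_max_derive (jet_near Dc d1) d11 maxP.
have [z2 n2] := local_max_derive (jet_near Dc d2) d22 maxP.
apply: (@ahlfors_algebra (p c) (q c) (r c) (s c) (c.1 - x0.1) (c.2 - x0.2) rho (w c)) => //.
rewrite -/(sqdist x0 c) -/(phi c) -/(N c).
have -> : sqdist x0 c - phi c = (c.1 - x0.1) ^+ 2 + (c.2 - x0.2) ^+ 2 - phi c by [].
have : l1 + l2 <= 0 by lra.
by apply: le_trans; rewrite le_eqVlt; apply/orP; left; apply/eqP;
  rewrite /l1 /l2 /N; ring.
Qed.
End InteriorMax.

(** Ahlfors-Schwarz comparison: on [D] the metric [|grad u|^2 / (u + rho/2)^2]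
    has curvature -1, as [log |grad u|] is harmonic, and on the boundary it
    equals [4 / rho ^ 2], the smallest value of the hyperbolic metric of the
    disk of radius [rho]; so it lies below that metric. *)
Lemma ahlfors_estimate x0 (rho : R) : D x0 -> 0 < rho ->
  N x0 * rho ^+ 2 <= 4 * (u x0 + rho / 2) ^+ 2.
Proof.
move=> Dx0 rho0.
pose phi y := rho ^+ 2 - sqdist x0 y.
pose w y := u y + rho / 2.
pose G y := N y * phi y ^+ 2 / w y ^+ 2.
have w0 y : 0 < w y by rewrite /w ltr_wpDl// divr_gt0.
have w20 y : 0 < w y ^+ 2 by rewrite exprn_gt0.
pose K := closure D `&` [set y | sqdist x0 y <= rho ^+ 2].
have cK : compact K by apply: compact_disk; [exact: ltW|exact: closed_closure].
have K0 : K !=set0.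
  by exists x0; split; [exact: subset_closure|rewrite /= sqdistxx sqr_ge0].
have cG : {within K, continuous G}.
  apply: (@continuous_subspaceW _ _ K (closure D)); first by move=> ? [].
  have cphi : {within closure D, continuous phi}.
    by apply: continuous_subspaceT => y; apply: cvgB; [exact: cvg_cst|exact: sqdist_continuous].
  have cw : {within closure D, continuous w}.
    by move=> y; apply: cvgD; [exact: (jet_cu J)|exact: cvg_cst].
  move=> y; rewrite /G; under eq_fun do rewrite !expr2.
  apply: cvgM; first by apply: cvgM; [exact: within_sqnorm_gradient|apply: cvgM; exact: cphi].
  by apply: cvgV; [rewrite mulf_neq0// gt_eqF|apply: cvgM; exact: cw].
have [c /set_mem[cD /= crho] cmax] := compact_EVT_max K0 cK cG.
have maxG y : closure D y -> sqdist x0 y <= rho ^+ 2 -> G y <= G c.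
  by move=> Dy yr; apply: cmax; rewrite inE.
(* The conclusion is the value at the centre, where [phi = rho ^ 2]. *)
suff Gc : G c <= 4 * rho ^+ 2.
  have := le_trans (maxG x0 (subset_closure Dx0) _) Gc.
  rewrite sqdistxx sqr_ge0 => /(_ isT).
  rewrite /G ler_pdivrMr// /phi sqdistxx subr0 /w => H.
  have r2 : 0 < rho ^+ 2 by rewrite exprn_gt0.
  rewrite -(ler_pM2r r2); apply: le_trans (le_trans H _).
    by rewrite le_eqVlt; apply/orP; left; apply/eqP; ring.
  by rewrite le_eqVlt; apply/orP; left; apply/eqP; ring.
have N_ge0 y : 0 <= N y by rewrite addr_ge0// sqr_ge0.
have rr : 0 <= 4 * rho ^+ 2 by rewrite mulr_ge0// sqr_ge0.
have phic : 0 <= phi c by rewrite subr_ge0.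
have phile : phi c <= rho ^+ 2 by rewrite lerBlDr lerDl sqdist_ge0.
have [Dc|nDc] := pselect (D c); last first.
  have [uc Nc] := bdry cD nDc.
  rewrite /G ler_pdivrMr// /w uc add0r /N Nc mul1r.
  have -> : 4 * rho ^+ 2 * (rho / 2) ^+ 2 = (rho ^+ 2) ^+ 2 by field.
  by rewrite ler_sqr// nnegrE ?sqr_ge0.
have [Nc0|Nc0] := eqVneq (N c) 0; first by rewrite /G Nc0 !mul0r.
have [pc0|pc0] := eqVneq (phi c) 0; first by rewrite /G pc0 expr0n mulr0 mul0r.
have Ncp : 0 < N c by rewrite lt_neqAle eq_sym Nc0 N_ge0.
have phicp : 0 < phi c by rewrite lt_neqAle eq_sym pc0.
apply: (@ahlfors_interior x0 c rho (G c)) => //.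
- by rewrite /G -/(w c) divfK// gt_eqF.
- have : \forall y \near c, D y /\ 0 < phi y.
    apply: filterI; first exact: jet_near.
    have : phi y @[y --> c] --> phi c by apply: cvgB; [exact: cvg_cst|exact: sqdist_continuous].
    by move=> /cvgr_gt; apply.
  apply: filterS => y [Dy py].
  rewrite subr_le0 -(ler_pdivrMr _ _ (w20 y)) -/(G y).
  by apply: maxG; [exact: subset_closure|rewrite -subr_ge0 ltW].
Qed.

(** Let the radius go to infinity in the previous estimate. *)
Lemma gradient_le1 x : D x -> p x ^+ 2 + q x ^+ 2 <= 1.
Proof.
move=> Dx; rewrite -/(N x) -[N x]sqr_sqrtr ?addr_ge0 ?sqr_ge0//.
rewrite expr_le1// ?sqrtr_ge0//.
apply/ler_addgt0Pr => e e0.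
have := u_ge0 x; rewrite le_eqVlt => /predU1P[ux|ux].
  have := ahlfors_estimate Dx ltr01; rewrite -ux add0r expr1n mulr1.
  have -> : 4 * (1 / 2) ^+ 2 = 1 :> R by field.
  by move=> /ler_wsqrtr; rewrite sqrtr1 => /le_trans; apply; rewrite lerDl ltW.
(* For this radius the bound [1 + 2 * u x / rho] equals [1 + e]. *)
pose rho := 2 * u x / e.
have rho0 : 0 < rho by rewrite divr_gt0// mulr_gt0.
have := ahlfors_estimate Dx rho0.
have -> : 4 * (u x + rho / 2) ^+ 2 = (2 * (u x + rho / 2)) ^+ 2 by ring.
move=> /ler_wsqrtr; rewrite sqrtrM ?addr_ge0 ?sqr_ge0// !sqrtr_sqr.
have wp : 0 <= 2 * (u x + rho / 2) by rewrite mulr_ge0// addr_ge0 ?u_ge0// divr_ge0// ltW.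
rewrite (ger0_norm wp) (gtr0_norm rho0) -ler_pdivlMr// => /le_trans; apply.
rewrite le_eqVlt; apply/orP; left; apply/eqP; rewrite /rho; field.
by rewrite !gt_eqF.
Qed.

End Estimate.
End Jet.

(** * Classical solutions *)

Section SolutionJet.
Variable R : realType.
Let e1 : R * R := basis_vector R false.
Let e2 : R * R := basis_vector R true.

Lemma trace_eq (D : set (R * R)) (f g : R * R -> R) x l : closure D x ->
  (\forall z \near x, D z -> f z = g z) ->
  g z @[z --> within (closure D) (nbhs x)] --> l -> trace D f x = l.
Proof.
move=> Dx fg gl; have PF : ProperFilter (within D (nbhs x)) by exact: within_nbhs_proper.
apply: cvg_lim => //.
have gl' : g z @[z --> within D (nbhs x)] --> l.
  apply: cvg_trans gl; apply: cvg_app => A wA.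
  have {}wA : \forall z \near x, closure D z -> A z := wA.
  suff : \forall z \near x, D z -> A z by [].
  by apply: filterS wA => z zA Dz; apply: zA; exact: subset_closure.
apply: cvg_trans gl'; apply: near_eq_cvg; rewrite near_withinE.
by apply: filterS fg => z fgz Dz; rewrite fgz.
Qed.

Lemma is_derive_ext (D : set (R * R)) (f g : R * R -> R) x v l :
  open D -> D x -> (forall y, D y -> f y = g y) ->
  is_derive x v f l -> is_derive x v g l.
Proof.
move=> oD Dx fg fl; apply: (near_eq_is_derive _ fl).
have DDx : \forall y \near x, D y by exact: (open_nbhs_nbhs (conj oD Dx)).
by apply: filterS DDx => y /fg.
Qed.

Variable U : R * R -> R.
Hypothesis solU : classical_solution U.
Let D := positive_phase U.

Lemma positive_phase_open : open D.
Proof.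
rewrite (_ : D = U @^-1` [set t | 0 < t])//.
apply: open_comp => [y _|]; last exact: open_gt.
exact: solution_continuous solU y.
Qed.

Lemma free_boundaryP x : free_boundary U x <-> closure D x /\ ~ D x.
Proof.
rewrite /free_boundary -/D.
by rewrite (interior_id _).1 //; exact: positive_phase_open.
Qed.

Lemma solution_zero x : ~ D x -> U x = 0.
Proof.
move=> nDx; apply/eqP; rewrite eq_le (solution_ge0 solU) andbT leNgt.
exact/negP.
Qed.

Lemma is_derive_partials (w : seq bool) x i : D x ->
  is_derive x (basis_vector R i) (partials w U) (partials (i :: w) U x).
Proof.
move=> Dx; apply: derivableP.
by have [+ _] := solution_smooth solU => /(_ w x Dx)[_]; exact.
Qed.

Lemma continuous_partials (w : seq bool) x : D x ->
  {for x, continuous (partials w U)}.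
Proof. by move=> Dx; have [+ _] := solution_smooth solU => /(_ w x Dx)[]. Qed.

Lemma partials_comm (w : seq bool) x : D x ->
  partials [:: true, false & w] U x = partials [:: false, true & w] U x.
Proof.
move=> Dx.
apply: (@mixed_partials_eq R (partials w U) (partials (false :: w) U) (partials (true :: w) U)
  (partials [:: true, false & w] U) (partials [:: false, true & w] U) x);
  try exact: continuous_partials.
have : \forall y \near x, D y by exact: (open_nbhs_nbhs (conj positive_phase_open Dx)).
by apply: filterS => y Dy; split; exact: is_derive_partials.
Qed.

Lemma partials_laplace x : D x ->
  partials [:: true; true] U x = - partials [:: false; false] U x.
Proof.
move=> Dx; have := solution_harmonic solU Dx.
by rewrite /laplacian /divergence => /eqP; rewrite addrC addr_eq0 => /eqP.
Qed.

(** The bridge to the harmonic jets. The curvature [div (grad U / |grad U|)]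
    loses its Laplacian part, and [|grad U| = 1] at the boundary, which leaves
    minus the second derivative of [U] in the direction of its gradient. *)
Lemma solution_jet : exists p q r s a b : R * R -> R,
  [/\ harmonic_jet D U p q r s a b,
      forall x, closure D x -> ~ D x -> U x = 0 /\ p x ^+ 2 + q x ^+ 2 = 1 &
      forall x, closure D x -> ~ D x -> curvature U x =
        - (p x * (p x * r x + q x * s x) + q x * (p x * s x - q x * r x))].
Proof.
have [_ /choice[E EP]] := solution_smooth solU.
have Ec w : {within closure D, continuous (E w)} by have [] := EP w.
have EE w x : D x -> partials w U x = E w x.
  by move=> Dx; have [_ h] := EP w; apply: h; rewrite inE.
have oD := positive_phase_open.
have dE w i x l : D x -> partials (i :: w) U x = l ->
    is_derive x (basis_vector R i) (E w) l.
  by move=> Dx <-; apply: (is_derive_ext oD Dx (EE w)); exact: is_derive_partials.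
exists (E [:: false]), (E [:: true]), (E [:: false; false]), (E [:: false; true]).
exists (partials [:: false; false; false] U), (partials [:: true; false; false] U).
have J : harmonic_jet D U (E [:: false]) (E [:: true]) (E [:: false; false]) (E [:: false; true])
   (partials [:: false; false; false] U) (partials [:: true; false; false] U).
  split => //.
  - by move=> x Dx; rewrite -EE//; exact: (is_derive_partials [::] false Dx).
  - by move=> x Dx; rewrite -EE//; exact: (is_derive_partials [::] true Dx).
  - by move=> x Dx; apply: dE => //; rewrite EE.
  - by move=> x Dx; apply: dE => //; rewrite partials_comm// EE.
  - by move=> x Dx; apply: dE => //; rewrite EE.
  - by move=> x Dx; apply: dE => //; rewrite partials_laplace// EE.
  - by move=> x Dx; apply: dE.
  - by move=> x Dx; apply: dE.
  - move=> x Dx; rewrite partials_comm//.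
    apply: (is_derive_ext oD Dx _ (is_derive_partials [:: true; false] false Dx)) => y Dy.
    by rewrite partials_comm// EE.
  - move=> x Dx; apply: dE => //; rewrite partials_comm//.
    have [_ <-] : is_derive x (basis_vector R false)
        (- partials [:: false; false] U) (- partials [:: false; false; false] U x).
      by apply: is_deriveN; exact: is_derive_partials.
    have [//] : is_derive x (basis_vector R false)
        (- partials [:: false; false] U) (partials [:: false; true; true] U x).
    apply: (is_derive_ext oD Dx _ (is_derive_partials [:: true; true] false Dx)) => y Dy.
    by rewrite partials_laplace.
  - exact/continuous_subspaceT/(solution_continuous solU).
have cE w x : closure D x -> E w z @[z --> within (closure D) (nbhs x)] --> E w x.
  by move=> Dx; exact: (subspace_continuousP _ _).1 (Ec w) x Dx.
have bg x : closure D x -> ~ D x -> boundary_gradient U x = (E [:: false] x, E [:: true] x).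
  move=> Dx nDx.
  have tE i : trace D (partial i U) x = E [:: i] x.
    apply: trace_eq (cE [:: i] x Dx) => //.
    have H : \forall z \near x, True by exact: filterT.
    by apply: filterS H => z _ Dz; exact: (EE [:: i] z Dz).
  by rewrite /boundary_gradient !tE.
have N1 x : closure D x -> ~ D x -> E [:: false] x ^+ 2 + E [:: true] x ^+ 2 = 1.
  move=> Dx nDx; have Fx : free_boundary U x by apply/free_boundaryP.
  have := solution_gradient solU Fx; rewrite bg// => H.
  by have := enorm_sqr (E [:: false] x, E [:: true] x); rewrite H expr1n /= => <-.
split => //.
  by move=> x Dx nDx; split; [exact: solution_zero|exact: N1].
move=> x Dx nDx.
set p := E [:: false]; set q := E [:: true]; set r := E [:: false; false]; set s := E [:: false; true].
pose N z := p z ^+ 2 + q z ^+ 2.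
pose k z := p z * (p z * r z + q z * s z) + q z * (p z * s z - q z * r z).
(* In [D] near [x], the divergence of [grad U / |grad U|] equals
   [- k / |grad U| ^ 3], which extends continuously to [x]. *)
apply: (@trace_eq D _ (fun z => - ((Num.sqrt (N z))^-1 ^+ 3 * k z))) => //.
  have NN : N z @[z --> within (closure D) (nbhs x)] --> N x.
    by rewrite /N; under eq_fun do rewrite !expr2; apply: cvgD; apply: cvgM; exact: cE.
  have : \forall z \near x, closure D z -> 0 < N z.
    by have /cvgr_gt := NN; apply; rewrite /N N1.
  apply: filterS => z Nz Dz; have {}Nz := Nz (subset_closure Dz).
  have XE i (y : R * R) : D y -> (Num.sqrt (N y))^-1 * E [:: i] y =
      (enorm (gradient U y))^-1 * partial i U y.
    by move=> Dy; rewrite /N /p /q -!(EE _ y Dy).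
  have sN : Num.sqrt (N z) != 0 by rewrite gt_eqF// sqrtr_gt0.
  have [p1 p2 q1 q2] : [/\ is_derive z e1 p (r z), is_derive z e2 p (s z),
      is_derive z e1 q (s z) & is_derive z e2 q (- r z)].
    by split; [exact: jet_p1 J _ Dz|exact: jet_p2 J _ Dz|exact: jet_q1 J _ Dz|exact: jet_q2 J _ Dz].
  have dN1 : is_derive z e1 N (2 * (p z * r z + q z * s z)).
    by rewrite /N; derive_eq; ring.
  have dN2 : is_derive z e2 N (2 * (p z * s z - q z * r z)).
    by rewrite /N; derive_eq; ring.
  have dX1 := is_derive_ext oD Dz (XE false)
    (is_derive_mulf (is_derive_invf (f := fun y => Num.sqrt (N y)) (x := z) sN
      (is_derive_sqrtf Nz dN1)) p1).
  have dX2 := is_derive_ext oD Dz (XE true)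
    (is_derive_mulf (is_derive_invf (f := fun y => Num.sqrt (N y)) (x := z) sN
      (is_derive_sqrtf Nz dN2)) q2).
  rewrite /divergence /partial.
  have [_ ->] := dX1; have [_ ->] := dX2.
  by rewrite /k invfM -/p -/q; field.
have -> : - (p x * (p x * r x + q x * s x) + q x * (p x * s x - q x * r x)) =
    - ((Num.sqrt (N x))^-1 ^+ 3 * k x) by rewrite /N N1// sqrtr1 invr1 expr1n mul1r.
have kk : k z @[z --> within (closure D) (nbhs x)] --> k x.
  by apply: cvgD; apply: cvgM; [exact: cE| |exact: cE| ];
    [apply: cvgD|apply: cvgB]; apply: cvgM; exact: cE.
have sN : (Num.sqrt (N z))^-1 @[z --> within (closure D) (nbhs x)] --> (Num.sqrt (N x))^-1.
  apply: cvgV; first by rewrite /N N1// sqrtr1 oner_neq0.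
  have NN : N z @[z --> within (closure D) (nbhs x)] --> N x.
    by rewrite /N; under eq_fun do rewrite !expr2; apply: cvgD; apply: cvgM; exact: cE.
  exact: (cvg_comp _ _ NN (@sqrt_continuous R (N x))).
apply: cvgN; apply: cvgM => //; rewrite exprS expr2.
under eq_fun do rewrite exprS expr2.
by apply: cvgM => //; apply: cvgM.
Qed.

End SolutionJet.

(** * First order expansion at the boundary *)

Section Boundary.
Variable R : realType.

Definition inward (D : set (R * R)) (y v : R * R) : Prop :=
  exists2 t0 : R, 0 < t0 & forall t, 0 < t < t0 -> D (y + t *: v).

Lemma line_continuous (y v : R * R) : continuous (fun t : R => y + t *: v).
Proof.
by move=> t; apply: cvgD; [exact: cvg_cst|apply: cvgZr_tmp; exact: cvg_id].
Qed.

Lemma line_near0 (y v : R * R) (P : set (R * R)) : (\forall z \near y, P z) ->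
  exists2 d : R, 0 < d & forall t, `|t| < d -> P (y + t *: v).
Proof.
have lc : (fun t : R => y + t *: v) @ (0 : R) --> y.
  by have := @line_continuous y v 0; rewrite /continuous_at scale0r addr0.
move=> /lc /nbhs_ballP[d /= d0 dP]; exists d => // t td.
by apply: dP; rewrite /ball/= sub0r normrN.
Qed.

Lemma open_inward D y v : open D -> D y -> inward D y v.
Proof.
move=> oD Dy.
have [t0 t00 tD] := line_near0 v (open_nbhs_nbhs (conj oD Dy)).
by exists t0 => // t /andP[t1 t2]; apply: tD; rewrite gtr0_norm.
Qed.

Lemma inward_closure D y v : inward D y v -> closure D y.
Proof.
move=> [t0 t00 tD] B /(line_near0 v)[d d0 dB].
pose t := Num.min t0 d / 2.
have m0 : 0 < Num.min t0 d by rewrite lt_min t00.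
have tt : 0 < t < Num.min t0 d by rewrite /t; apply/andP; split; lra.
have /andP[t1] := tt; rewrite lt_min => /andP[t2 t3].
exists (y + t *: v); split; first by apply: tD; rewrite t1.
by apply: dB; rewrite gtr0_norm.
Qed.

(** The mean value theorem on the half-open segment, which lies in [D] except
    for its end point; there the derivative is only a boundary value. *)
Lemma inward_taylor D (f df : R * R -> R) y v :
  {within closure D, continuous f} -> {within closure D, continuous df} ->
  (forall x, D x -> is_derive x v f (df x)) -> inward D y v ->
  forall e : R, 0 < e -> exists2 t1 : R, 0 < t1 &
    forall t, 0 < t < t1 -> `|f (y + t *: v) - f y - t * df y| <= e * t.
Proof.
move=> cf cdf fdf yv e e0; have cy := inward_closure yv.
have [t0 t00 tD] := yv.
have /cvgrPdist_le/(_ _ e0) := (subspace_continuousP _ _).1 cdf y cy.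
rewrite near_withinE => dfy.
have [d d0 dP] := line_near0 v dfy.
exists (Num.min t0 d); first by rewrite lt_min t00.
move=> t /andP[t1]; rewrite lt_min => /andP[t2 t3].
pose h s := f (y + s *: v).
have h0 : h 0 = f y by rewrite /h scale0r addr0.
have tcl s : 0 <= s -> s <= t -> closure D (y + s *: v).
  rewrite le_eqVlt => /predU1P[<- _|s0 st]; first by rewrite scale0r addr0.
  by apply: subset_closure; apply: tD; rewrite s0 (le_lt_trans st).
have [||c] := MVT (f := h) (df := fun s => df (y + s *: v)) t1.
- move=> s; rewrite in_itv/= => /andP[s0 st]; apply: is_derive_line; apply: fdf.
  by apply: tD; rewrite s0 (lt_trans st).
- apply/subspace_continuousP => s; rewrite /= in_itv/= => /andP[s0 st].
  have := (subspace_continuousP _ _).1 cf (y + s *: v) (tcl s s0 st).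
  move=> fc A /fc H.
  have {}H : \forall z \near y + s *: v, closure D z -> A (f z) := H.
  have := @line_continuous y v s _ H.
  suff K : (\forall z \near s, closure D (y + z *: v) -> A (h z)) ->
      \forall z \near s, `[0, t]%classic z -> A (h z) by exact: K.
  by apply: filterS => z zA; rewrite /= in_itv/= => /andP[z0 zt]; exact/zA/tcl.
rewrite in_itv/= subr0 => /andP[c0 ct]; rewrite h0 => E.
rewrite -/(h t) E mulrC -mulrBr normrM gtr0_norm// mulrC ler_pM2r//.
rewrite distrC; apply: (dP c); last by apply: tcl; exact: ltW.
by rewrite gtr0_norm// (lt_trans ct).
Qed.

Lemma le0_of_small (x k : R) : 0 <= k ->
  (forall e : R, 0 < e -> x <= k * e) -> x <= 0.
Proof.
move=> k0 H; apply/ler_addgt0Pr => e e0; rewrite add0r.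
have k1 : 0 < k + 1 by rewrite ltr_wpDl.
apply: le_trans (H (e / (k + 1)) _) _; first by rewrite divr_gt0.
by rewrite mulrCA ger_pMr// ler_pdivrMr// mul1r lerDl.
Qed.

Lemma linear_ge0_slope (x k : R) : (forall l : R, 0 <= x + l * k) -> k = 0.
Proof.
move=> H; apply/eqP/negPn/negP => k0.
by have := H (- (x + 1) / k); rewrite divfK//; lra.
Qed.

Section JetBoundary.
Variables (D : set (R * R)) (u p q r s a b : R * R -> R).
Hypothesis J : harmonic_jet D u p q r s a b.
Hypothesis u_ge0 : forall x, 0 <= u x.
Hypothesis bdry : forall x, closure D x -> ~ D x ->
  u x = 0 /\ p x ^+ 2 + q x ^+ 2 = 1.

Let N x := p x ^+ 2 + q x ^+ 2.
Let b1 x := p x * r x + q x * s x.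
Let b2 x := p x * s x - q x * r x.

Let cD f x (cf : {within closure D, continuous f}) (Dx : D x) :=
  within_closure_continuous (jet_open J) cf Dx.

Lemma jet_is_derive_u x v : D x -> is_derive x v u (v.1 * p x + v.2 * q x).
Proof.
move=> Dx; apply: C1_is_derive.
- by apply: (jet_near J Dx) => y Dy; split; [exact: jet_u1 J _ Dy|exact: jet_u2 J _ Dy].
- exact: cD (jet_cp J) Dx.
- exact: cD (jet_cq J) Dx.
Qed.

Lemma jet_is_derive_p x v : D x -> is_derive x v p (v.1 * r x + v.2 * s x).
Proof.
move=> Dx; apply: C1_is_derive.
- by apply: (jet_near J Dx) => y Dy; split; [exact: jet_p1 J _ Dy|exact: jet_p2 J _ Dy].
- exact: cD (jet_cr J) Dx.
- exact: cD (jet_cs J) Dx.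
Qed.

Lemma jet_is_derive_q x v : D x -> is_derive x v q (v.1 * s x - v.2 * r x).
Proof.
move=> Dx; rewrite -mulrN.
apply: (C1_is_derive (d2 := fun y => - r y)).
- by apply: (jet_near J Dx) => y Dy; split; [exact: jet_q1 J _ Dy|exact: jet_q2 J _ Dy].
- exact: cD (jet_cs J) Dx.
- by apply: cvgN; exact: cD (jet_cr J) Dx.
Qed.

Lemma jet_is_derive_N x v : D x ->
  is_derive x v N (2 * (v.1 * b1 x + v.2 * b2 x)).
Proof.
move=> Dx; have := jet_is_derive_p v Dx; have := jet_is_derive_q v Dx.
by move=> dq dp; rewrite /N; derive_eq; rewrite /b1 /b2; ring.
Qed.

Lemma within_b1 : {within closure D, continuous b1}.
Proof.
by move=> x; apply: cvgD; apply: cvgM;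
  [exact: jet_cp J x|exact: jet_cr J x|exact: jet_cq J x|exact: jet_cs J x].
Qed.

Lemma within_b2 : {within closure D, continuous b2}.
Proof.
by move=> x; apply: cvgB; apply: cvgM;
  [exact: jet_cp J x|exact: jet_cs J x|exact: jet_cq J x|exact: jet_cr J x].
Qed.

Lemma jet_N_le1 x : closure D x -> N x <= 1.
Proof.
move=> cx; have [Dx|nDx] := pselect (D x); first exact: (gradient_le1 J u_ge0 bdry Dx).
by rewrite /N (bdry cx nDx).2.
Qed.

(** [u] vanishes at [y] and is nonnegative along the inward vector. *)
Lemma inward_gradient_ge0 y v : closure D y -> ~ D y -> inward D y v ->
  0 <= v.1 * p y + v.2 * q y.
Proof.
move=> cy nDy yv; rewrite -oppr_le0; apply: (@le0_of_small _ 1) => // e e0.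
have c : {within closure D, continuous (fun x => v.1 * p x + v.2 * q x)}.
  by move=> x; apply: cvgD; apply: cvgM; do ?[exact: cvg_cst];
    [exact: jet_cp J x|exact: jet_cq J x].
have [t1 t10 H] := inward_taylor (jet_cu J) c (fun x => @jet_is_derive_u x v) yv e0.
have t2 : 0 < t1 / 2 < t1 by apply/andP; split; lra.
have /andP[t20 _] := t2.
have := H _ t2; rewrite (bdry cy nDy).1 subr0 ler_norml => /andP[_].
have := u_ge0 (y + (t1 / 2) *: v) => ug h.
rewrite mul1r -(ler_pM2l t20) mulrN; apply: le_trans (_ : _ <= e * (t1 / 2)) _; last by rewrite mulrC.
by lra.
Qed.

(** [N] decreases from its maximum [1] along inward vectors; half of its
    derivative is the left-hand side. *)
Lemma inward_N_le0 y v : N y = 1 -> inward D y v -> v.1 * b1 y + v.2 * b2 y <= 0.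
Proof.
move=> Ny yv; apply: (@le0_of_small _ 1) => // e e0.
have c : {within closure D, continuous (fun x => 2 * (v.1 * b1 x + v.2 * b2 x))}.
  move=> x; apply: cvgM; first exact: cvg_cst.
  by apply: cvgD; apply: cvgM; do ?[exact: cvg_cst];
    [exact: within_b1|exact: within_b2].
have [t1 t10 H] := inward_taylor (within_sqnorm_gradient J) c (fun x => @jet_is_derive_N x v) yv e0.
have [t0 t00 tD] := yv.
pose t := Num.min t0 t1 / 2.
have m0 : 0 < Num.min t0 t1 by rewrite lt_min t00.
have tt : 0 < t < Num.min t0 t1 by rewrite /t; apply/andP; split; lra.
have /andP[tp] := tt; rewrite lt_min => /andP[tt0 tt1].
have := H t; rewrite tp tt1 -/(N _) -/(N y) Ny => /(_ isT).
have Dt : D (y + t *: v) by apply: tD; rewrite tp.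
have Nt := jet_N_le1 (subset_closure Dt).
rewrite ler_norml => /andP[+ _] => h.
rewrite mul1r -(ler_pM2l tp); have := mulr_gt0 tp e0; lra.
Qed.

End JetBoundary.
End Boundary.

(** * Sign of the curvature and Hopf's lemma *)

Section InwardNormal.
Variable R : realType.

(** The vector [m] is normal to the tangent line of the graph at [y], pointing
    to the positive side: a vector that is not tangent leaves the graph on the
    side to which it points. *)
Lemma graph_sides (U : R * R -> R) y :
  smooth_free_boundary U -> free_boundary U y ->
  exists2 m : R * R, 0 < m.1 ^+ 2 + m.2 ^+ 2 &
    forall v, (0 < v.1 * m.1 + v.2 * m.2 -> inward (positive_phase U) y v) /\
      (v.1 * m.1 + v.2 * m.2 < 0 -> inward (~` positive_phase U) y v).
Proof.
move=> sF Fy; have [nu [d [eps [g [nu1 d0 eps0 gs P]]]]] := sF y Fy.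
have nn : nu.1 ^+ 2 + nu.2 ^+ 2 = 1 by rewrite -enorm_sqr nu1 expr1n.
have g0 : g 0 = 0.
  have := P 0 0; rewrite !normr0 => /(_ d0 eps0)[[+ _] _ _].
  by rewrite !scale0r !addr0 => /(_ Fy).
have [k gk] : exists k : R, is_derive (0 : R) 1 g k.
  have := gs 0 0; rewrite normr0 => /(_ d0) dg.
  by exists ('D_1 g 0); exact: derivableP.
(* In the coordinates [(s, t)] this is the vector [(- g'(0), 1)]. *)
exists (nu.1 - k * nu.2, nu.2 + k * nu.1) => /=.
  have -> : (nu.1 - k * nu.2) ^+ 2 + (nu.2 + k * nu.1) ^+ 2 =
    (1 + k ^+ 2) * (nu.1 ^+ 2 + nu.2 ^+ 2) by ring.
  by rewrite nn mulr1 ltr_pwDl// sqr_ge0.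
move=> v.
pose s := v.1 * nu.2 - v.2 * nu.1; pose t := v.1 * nu.1 + v.2 * nu.2.
have -> : v.1 * (nu.1 - k * nu.2) + v.2 * (nu.2 + k * nu.1) = t - k * s.
  by rewrite /s /t; ring.
have vE : v = s *: (nu.2, - nu.1) + t *: nu.
  have E1 : v.1 = s * nu.2 + t * nu.1.
    by rewrite -[LHS]mulr1 -nn /s /t; ring.
  have E2 : v.2 = s * - nu.1 + t * nu.2.
    by rewrite -[LHS]mulr1 -nn /s /t; ring.
  by rewrite [LHS]surjective_pairing; congr pair; [exact: E1|exact: E2].
have s1 : 0 < `|s| + 1 by rewrite ltr_wpDl.
have t1 : 0 < `|t| + 1 by rewrite ltr_wpDl.
suff side : t - k * s != 0 -> exists2 m : R, 0 < m &
    forall h, 0 < h < m -> (g (h * s) < h * t -> 0 < U (y + h *: v)) /\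
      (h * t < g (h * s) -> U (y + h *: v) = 0) /\
      `|g (h * s) - h * (k * s)| < h * `|t - k * s|.
  split=> c0.
    have [m m0 mP] := side (lt0r_neq0 c0); exists m => // h hm.
    have [+ [_]] := mP h hm; have /andP[h0 _] := hm.
    rewrite (gtr0_norm c0) => P1 /(le_lt_trans (ler_norm _)) H; apply: P1.
    by move: H; rewrite mulrBr; lra.
  have [m m0 mP] := side (ltr0_neq0 c0); exists m => // h hm.
  have [_ [+]] := mP h hm; have /andP[h0 _] := hm.
  rewrite (ltr0_norm c0) distrC => P1 /(le_lt_trans (ler_norm _)) H.
  rewrite /positive_phase /= P1 ?ltxx//.
  by move: H; rewrite opprB mulrBr; lra.
move=> c0; have c1 : 0 < `|t - k * s| by rewrite normr_gt0.
have e0 : 0 < `|t - k * s| / (2 * (`|s| + 1)) by rewrite divr_gt0// mulr_gt0.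
have [d1 d10 gd] := is_derive_small gk e0.
pose m := Num.min (Num.min d d1 / (`|s| + 1)) (eps / (`|t| + 1)).
have m0 : 0 < m by rewrite lt_min !divr_gt0// lt_min d0.
exists m => // h /andP[h0]; rewrite lt_min => /andP[].
rewrite !ltr_pdivlMr// lt_min => /andP[hd hd1] heps.
have hs (z : R) : `|h * z| < h * (`|z| + 1).
  by rewrite normrM (gtr0_norm h0) ltr_pM2l// ltrDl.
have := P (h * s) (h * t) (lt_trans (hs _) hd) (lt_trans (hs _) heps).
have -> : y + (h * s) *: (nu.2, - nu.1) + (h * t) *: nu = y + h *: v.
  by rewrite -addrA [in RHS]vE scalerDr !scalerA.
move=> [_ P1 P2]; split=> //; split=> //.
have := gd (h * s) (lt_trans (hs _) hd1).
rewrite g0 add0r subr0 [_ *: 1]mulr1 -mulrA [s * k]mulrC => /le_lt_trans; apply.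
apply: le_lt_trans (_ : _ <= `|t - k * s| / (2 * (`|s| + 1)) * (h * (`|s| + 1))) _.
  by rewrite ler_pM2l// ltW.
have -> : `|t - k * s| / (2 * (`|s| + 1)) * (h * (`|s| + 1)) = h * `|t - k * s| / 2.
  by field; rewrite gt_eqF.
by have := mulr_gt0 h0 c1; lra.
Qed.

End InwardNormal.

Section BoundaryCurvature.
Variable R : realType.
Let e1 : R * R := basis_vector R false.
Let e2 : R * R := basis_vector R true.
Variables (D : set (R * R)) (u p q r s a b : R * R -> R).
Hypothesis J : harmonic_jet D u p q r s a b.
Hypothesis u_ge0 : forall x, 0 <= u x.
Hypothesis bdry : forall x, closure D x -> ~ D x ->
  u x = 0 /\ p x ^+ 2 + q x ^+ 2 = 1.
Let N x := p x ^+ 2 + q x ^+ 2.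
Let b1 x := p x * r x + q x * s x.
Let b2 x := p x * s x - q x * r x.

Section AtPoint.
Variable y : R * R.
Hypotheses (cy : closure D y) (nDy : ~ D y).
Variable m : R * R.
Hypothesis m0 : 0 < m.1 ^+ 2 + m.2 ^+ 2.
Hypothesis inm : forall v, 0 < v.1 * m.1 + v.2 * m.2 -> inward D y v.

(** As [u >= 0], the gradient makes an angle at most [pi / 2] with every vector
    of the open half plane of inward vectors, hence is normal. *)
Lemma inward_of_gradient v : 0 < v.1 * p y + v.2 * q y -> inward D y v.
Proof.
move=> vn; apply: inm.
have Ny : p y ^+ 2 + q y ^+ 2 = 1 by exact: (bdry cy nDy).2.
have H l : 0 <= (p y * m.1 + q y * m.2) + l * (q y * m.1 - p y * m.2).
  have := inward_gradient_ge0 J u_ge0 bdry cy nDy (inm (v := (m.1 - l * m.2, m.2 + l * m.1)) _).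
  have E1 : (m.1 - l * m.2) * m.1 + (m.2 + l * m.1) * m.2 = m.1 ^+ 2 + m.2 ^+ 2 by ring.
  rewrite /= E1 => /(_ m0).
  suff -> : (m.1 - l * m.2) * p y + (m.2 + l * m.1) * q y =
    (p y * m.1 + q y * m.2) + l * (q y * m.1 - p y * m.2) by [].
  by ring.
have k0 := linear_ge0_slope H.
have := H 0; rewrite mul0r addr0 => pm.
have E : (p y * m.1 + q y * m.2) ^+ 2 = m.1 ^+ 2 + m.2 ^+ 2.
  have -> : (p y * m.1 + q y * m.2) ^+ 2 = (p y ^+ 2 + q y ^+ 2) *
      (m.1 ^+ 2 + m.2 ^+ 2) - (q y * m.1 - p y * m.2) ^+ 2 by ring.
  by rewrite k0 Ny mul1r expr0n subr0.
have pm0 : 0 < p y * m.1 + q y * m.2.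
  rewrite lt_neqAle pm andbT eq_sym; apply/eqP => z.
  by move: m0; rewrite -E z expr0n ltxx.
rewrite -(pmulr_rgt0 _ pm0).
have -> : (p y * m.1 + q y * m.2) * (v.1 * m.1 + v.2 * m.2) =
    (m.1 ^+ 2 + m.2 ^+ 2) * (v.1 * p y + v.2 * q y)
    - (q y * m.1 - p y * m.2) * (v.2 * m.1 - v.1 * m.2) by ring.
by rewrite k0 mul0r subr0 mulr_gt0.
Qed.

Lemma normal_second_derivative_le0 : p y * b1 y + q y * b2 y <= 0.
Proof.
have Ny : p y ^+ 2 + q y ^+ 2 = 1 by exact: (bdry cy nDy).2.
apply: (inward_N_le0 J u_ge0 bdry (v := (p y, q y))) => //.
by apply: inward_of_gradient; rewrite /= -!expr2 Ny.
Qed.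

(** Where the curvature vanishes, so does the whole gradient of [N]: its
    tangential part is tested with inward vectors almost tangent to the
    boundary, on both sides. *)
Lemma normal_second_derivative_eq0 : p y * b1 y + q y * b2 y = 0 ->
  b1 y = 0 /\ b2 y = 0.
Proof.
have Ny : p y ^+ 2 + q y ^+ 2 = 1 by exact: (bdry cy nDy).2.
move=> z.
have H l : 0 <= 0 + l * (q y * b1 y - p y * b2 y).
  have vin : inward D y (p y - l * q y, q y + l * p y).
    apply: inward_of_gradient => /=.
    suff -> : (p y - l * q y) * p y + (q y + l * p y) * q y = p y ^+ 2 + q y ^+ 2.
      by rewrite Ny.
    by ring.
  have := inward_N_le0 J u_ge0 bdry Ny vin.
  by move: z; rewrite /= -/(b1 y) -/(b2 y); lra.
have k0 := linear_ge0_slope H.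
split.
  rewrite -[LHS]mul1r -Ny.
  have -> : (p y ^+ 2 + q y ^+ 2) * b1 y =
      p y * (p y * b1 y + q y * b2 y) + q y * (q y * b1 y - p y * b2 y) by ring.
  by rewrite z k0 !mulr0 addr0.
rewrite -[LHS]mul1r -Ny.
have -> : (p y ^+ 2 + q y ^+ 2) * b2 y =
    q y * (p y * b1 y + q y * b2 y) - p y * (q y * b1 y - p y * b2 y) by ring.
by rewrite z k0 !mulr0 subr0.
Qed.

End AtPoint.

(** Hopf's lemma for the superharmonic function [1 - N >= 0], positive on a
    disk. On an annulus thin enough for the barrier [bar], a polynomial in the
    squared distance to the centre, to be subharmonic, [1 - N] dominates a
    multiple of [bar], whose derivative at the contact point [y] is not [0]. *)
Lemma hopf x0 y (rho : R) : 0 < rho -> sqdist x0 y = rho ^+ 2 -> N y = 1 ->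
  (forall x, sqdist x0 x < rho ^+ 2 -> D x /\ N x < 1) ->
  b1 y = 0 -> b2 y = 0 -> False.
Proof.
move=> rho0 yrho Ny dk b1y b2y.
pose bar x := (rho ^+ 2 - sqdist x0 x) * (3 / 2 * rho ^+ 2 - sqdist x0 x).
have r2 : 0 < rho ^+ 2 by rewrite exprn_gt0.
have r4 : 0 < rho ^+ 4 by rewrite exprn_gt0.
have [M M1 NM] : exists2 M, M < 1 & forall x, sqdist x0 x <= 3 / 4 * rho ^+ 2 -> N x <= M.
  have q0 : 0 <= 3 / 4 * rho ^+ 2 by rewrite mulr_ge0// ltW.
  pose K := [set: R * R] `&` [set x | sqdist x0 x <= Num.sqrt (3 / 4 * rho ^+ 2) ^+ 2].
  have KD x : K x -> sqdist x0 x < rho ^+ 2.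
    by move=> [_]; rewrite /= sqr_sqrtr// => /le_lt_trans; apply; lra.
  have cK : compact K by apply: compact_disk; [exact: sqrtr_ge0|exact: closedT].
  have K0 : K !=set0 by exists x0; split => //=; rewrite sqdistxx sqr_ge0.
  have cN : {within K, continuous N}.
    apply: continuous_subspaceW (within_sqnorm_gradient J) => x Kx.
    by apply: subset_closure; exact: (dk _ (KD _ Kx)).1.
  have [c /set_mem Kc cmax] := compact_EVT_max K0 cK cN.
  exists (N c); first exact: (dk _ (KD _ Kc)).2.
  by move=> x xr; apply: cmax; rewrite inE; split => //=; rewrite sqr_sqrtr.
(* On the inner circle [bar = 3 / 16 * rho ^ 4], so there [N + ep * bar < 1]. *)
pose ep := (1 - M) / rho ^+ 4.
have ep0 : 0 < ep by rewrite divr_gt0// subr_gt0.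
pose f x := N x + ep * bar x.
have key x : D x -> 3 / 4 * rho ^+ 2 <= sqdist x0 x <= rho ^+ 2 -> f x <= 1.
  pose K := closure D `&` [set x | sqdist x0 x <= rho ^+ 2]
    `&` [set x | 3 / 4 * rho ^+ 2 <= sqdist x0 x].
  have cK : compact K.
    apply: (@subclosed_compact _ _ (closure D `&` [set x | sqdist x0 x <= rho ^+ 2])).
    - apply: closedI.
        apply: closedI; first exact: closed_closure.
        rewrite (_ : [set x | _] = sqdist x0 @^-1` [set t | t <= rho ^+ 2])//.
        by apply: closed_comp => [z _|]; [exact: sqdist_continuous|exact: closed_le].
      rewrite (_ : [set x | _] = sqdist x0 @^-1` [set t | 3 / 4 * rho ^+ 2 <= t])//.
      by apply: closed_comp => [z _|]; [exact: sqdist_continuous|exact: closed_ge].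
    - by apply: compact_disk; [exact: ltW|exact: closed_closure].
    - by move=> z [].
  move=> Dx /andP[xa xb].
  have K0 : K !=set0 by exists x; split => //; split => //; exact: subset_closure.
  have cbar : continuous bar.
    by move=> z; apply: cvgM; apply: cvgB; do ?[exact: cvg_cst];
      exact: sqdist_continuous.
  have cf : {within K, continuous f}.
    apply: (@continuous_subspaceW _ _ K (closure D)); first by move=> z [[]].
    move=> z; apply: cvgD; first exact: within_sqnorm_gradient J _.
    by apply: cvgM; [exact: cvg_cst|exact: (continuous_subspaceT cbar)].
  have [c /set_mem[[cD cr] ca] cmax] := compact_EVT_max K0 cK cf.
  rewrite /= in cr ca.
  have fmax z : closure D z -> sqdist x0 z <= rho ^+ 2 ->
      3 / 4 * rho ^+ 2 <= sqdist x0 z -> f z <= f c.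
    by move=> *; apply: cmax; rewrite inE.
  apply: le_trans (fmax x (subset_closure Dx) xb xa) _.
  move: cr; rewrite le_eqVlt => /predU1P[cE|cr].
    by rewrite /f /bar cE subrr mul0r mulr0 addr0; exact: (jet_N_le1 J u_ge0 bdry).
  move: ca; rewrite le_eqVlt => /predU1P[cE|ca].
    rewrite /f /bar -cE.
    have -> : ep * ((rho ^+ 2 - 3 / 4 * rho ^+ 2) * (3 / 2 * rho ^+ 2 - 3 / 4 * rho ^+ 2)) =
        (1 - M) * (3 / 16).
      by rewrite /ep; field; rewrite gt_eqF.
    have Nc : N c <= M by apply: NM; rewrite cE.
    lra.
  have Dc : D c := (dk c cr).1.
  have fcmax : \forall z \near c, f z <= f c.
    have H : \forall z \near c, [/\ D z, sqdist x0 z < rho ^+ 2 & 3 / 4 * rho ^+ 2 < sqdist x0 z].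
      have sc : sqdist x0 z @[z --> c] --> sqdist x0 c by exact: sqdist_continuous.
      near=> z; split; near: z.
      - exact: (jet_near J Dc).
      - by have /cvgr_lt := sc; apply.
      - by have /cvgr_gt := sc; apply.
    apply: filterS H => z [Dz z1 z2].
    by apply: fmax; [exact: subset_closure|exact: ltW|exact: ltW].
  pose f1 z := 2 * (p z * r z + q z * s z)
    - ep * (2 * (z.1 - x0.1) * (5 / 2 * rho ^+ 2 - 2 * sqdist x0 z)).
  pose f2 z := 2 * (p z * s z - q z * r z)
    - ep * (2 * (z.2 - x0.2) * (5 / 2 * rho ^+ 2 - 2 * sqdist x0 z)).
  have d1 z : D z -> is_derive z e1 f (f1 z).
    move=> Dz; have := jet_p1 J Dz; have := jet_q1 J Dz.
    move=> *; rewrite /f /N /bar /sqdist; derive_eq.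
    by rewrite /f1 /e1 /sqdist /=; field.
  have d2 z : D z -> is_derive z e2 f (f2 z).
    move=> Dz; have := jet_p2 J Dz; have := jet_q2 J Dz.
    move=> *; rewrite /f /N /bar /sqdist; derive_eq.
    by rewrite /f2 /e2 /sqdist /=; field.
  pose l1 := 2 * (r c ^+ 2 + s c ^+ 2 + p c * a c + q c * b c)
    - ep * (5 * rho ^+ 2 - 4 * sqdist x0 c - 8 * (c.1 - x0.1) ^+ 2).
  pose l2 := 2 * (r c ^+ 2 + s c ^+ 2 - p c * a c - q c * b c)
    - ep * (5 * rho ^+ 2 - 4 * sqdist x0 c - 8 * (c.2 - x0.2) ^+ 2).
  have d11 : is_derive c e1 f1 l1.
    have := jet_p1 J Dc; have := jet_q1 J Dc; have := jet_r1 J Dc; have := jet_s1 J Dc.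
    move=> *; rewrite /f1 /sqdist; derive_eq.
    by rewrite /l1 /e1 /sqdist /=; field.
  have d22 : is_derive c e2 f2 l2.
    have := jet_p2 J Dc; have := jet_q2 J Dc; have := jet_r2 J Dc; have := jet_s2 J Dc.
    move=> *; rewrite /f2 /sqdist; derive_eq.
    by rewrite /l2 /e2 /sqdist /=; field.
  have [_ n1] := local_max_derive (jet_near J Dc d1) d11 fcmax.
  have [_ n2] := local_max_derive (jet_near J Dc d2) d22 fcmax.
  have S : l1 + l2 = 4 * (r c ^+ 2 + s c ^+ 2) + ep * (16 * sqdist x0 c - 10 * rho ^+ 2).
    by rewrite /l1 /l2 /sqdist; ring.
  have : 0 < ep * (16 * sqdist x0 c - 10 * rho ^+ 2) by rewrite mulr_gt0//; lra.
  by have := sqr_ge0 (r c); have := sqr_ge0 (s c); lra.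
pose v := (x0.1 - y.1, x0.2 - y.2).
have sv t : sqdist x0 (y + t *: v) = (1 - t) ^+ 2 * rho ^+ 2.
  by rewrite -yrho /sqdist /v /= /GRing.scale/=; ring.
have dv t : 0 < t < 1 -> D (y + t *: v).
  move=> /andP[t0 t1]; apply: (dk _ _).1; rewrite sv gtr_pMl//.
  by rewrite expr_lt1 ?subr_ge0 ?ltW// gtrBl.
have yv : inward D y v by exists 1.
have c : {within closure D, continuous (fun x => 2 * (v.1 * b1 x + v.2 * b2 x))}.
  move=> x; apply: cvgM; first exact: cvg_cst.
  by apply: cvgD; apply: cvgM; do ?[exact: cvg_cst];
    [exact: within_b1 J _|exact: within_b2 J _].
have e0 : 0 < ep * rho ^+ 4 / 4 by rewrite divr_gt0// mulr_gt0.
have [t1 t10 H] := inward_taylor (within_sqnorm_gradient J) c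
  (fun x => @jet_is_derive_N _ _ _ _ _ _ _ _ _ J x v) yv e0.
(* For [t < 1 / 8] the point [y + t v] stays in the annulus. *)
pose t := Num.min t1 (1 / 8) / 2.
have m0 : 0 < Num.min t1 (1 / 8) by rewrite lt_min t10 divr_gt0.
have tt : 0 < t < Num.min t1 (1 / 8) by rewrite /t; apply/andP; split; lra.
have /andP[tp] := tt; rewrite lt_min => /andP[tt1 tt8].
have := H t; rewrite tp tt1 -/(N _) -/(N y) Ny b1y b2y => /(_ isT).
rewrite !mulr0 addr0 !mulr0 subr0 ler_norml => /andP[+ _].
have Dt : D (y + t *: v) by apply: dv; rewrite tp; lra.
have := key _ Dt; rewrite /f /bar sv.
have -> : 3 / 4 * rho ^+ 2 <= (1 - t) ^+ 2 * rho ^+ 2 <= rho ^+ 2.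
  by rewrite ler_pM2r// ger_pMl//; apply/andP; split; nra.
move=> /(_ isT) h1 h2.
have : ep * ((rho ^+ 2 - (1 - t) ^+ 2 * rho ^+ 2) *
    (3 / 2 * rho ^+ 2 - (1 - t) ^+ 2 * rho ^+ 2)) <= ep * rho ^+ 4 / 4 * t by lra.
have -> : ep * ((rho ^+ 2 - (1 - t) ^+ 2 * rho ^+ 2) * (3 / 2 * rho ^+ 2 - (1 - t) ^+ 2 * rho ^+ 2))
  = ep * rho ^+ 4 * ((1 - (1 - t) ^+ 2) * (3 / 2 - (1 - t) ^+ 2)) by ring.
have -> : ep * rho ^+ 4 / 4 * t = ep * rho ^+ 4 * (t / 4) by field.
rewrite (ler_pM2l (mulr_gt0 ep0 r4)).
by apply/negP; rewrite -ltNge; nra.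
Unshelve. all: by end_near. Qed.

(** The largest disk around a point with [N < 1] that stays in [D] and on which
    [N < 1] contradicts Hopf's lemma at a contact point, whether that point is
    interior to [D] or on the boundary. *)
Lemma gradient_eq1 z0 : closure D z0 -> ~ D z0 ->
  (forall y, closure D y -> ~ D y -> b1 y = 0 /\ b2 y = 0) ->
  forall x, D x -> N x = 1.
Proof.
move=> cz0 nDz0 b0 x0 Dx0; apply/eqP; rewrite eq_le.
rewrite (jet_N_le1 J u_ge0 bdry (subset_closure Dx0)) leNgt; apply/negP => Nx0.
pose Z := [set x | D x -> N x = 1].
have cZ : closed Z.
  rewrite (_ : Z = ~` (D `&` [set x | N x != 1])); last first.
    apply/seteqP; split => x /= => [h [Dx /eqP]|h Dx].
      by apply; exact: h.
    by apply/eqP/negPn/negP => n; apply: h.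
  apply: open_closedC; rewrite openE => x [Dx Nx].
  have cN : {for x, continuous N}.
    exact: (within_closure_continuous (jet_open J) (within_sqnorm_gradient J) Dx).
  apply: filterI; first exact: (jet_near J Dx).
  have : N z @[z --> x] --> N x by exact: cN.
  have N1 : N x < 1 by rewrite lt_neqAle Nx (jet_N_le1 J u_ge0 bdry (subset_closure Dx)).
  by move=> /cvgr_lt /(_ _ N1); apply: filterS => z; rewrite /= => /lt_eqF ->.
pose d := Num.sqrt (sqdist x0 z0).
have cK : compact (Z `&` [set x | sqdist x0 x <= d ^+ 2]).
  by apply: compact_disk => //; exact: sqrtr_ge0.
have K0 : Z `&` [set x | sqdist x0 x <= d ^+ 2] !=set0.
  by exists z0; split => //=; rewrite sqr_sqrtr// sqdist_ge0.
have cs := continuous_subspaceT (A := Z `&` [set x | sqdist x0 x <= d ^+ 2]) (@sqdist_continuous R x0).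
have [y /set_mem[Zy yd] ymin] := compact_EVT_min K0 cK cs.
pose rho := Num.sqrt (sqdist x0 y).
have rhoE : sqdist x0 y = rho ^+ 2 by rewrite sqr_sqrtr// sqdist_ge0.
have dk x : sqdist x0 x < rho ^+ 2 -> D x /\ N x < 1.
  move=> xr; have nZ : ~ Z x.
    move=> Zx; have : sqdist x0 y <= sqdist x0 x.
      by apply: ymin; rewrite inE; split => //=; rewrite (le_trans (ltW xr))// -rhoE.
    by rewrite rhoE leNgt xr.
  have [Dx Nx] : D x /\ N x <> 1.
    by split; apply: contrapT => h; apply: nZ => // Dx; apply: contrapT => k; exact: h.
  split=> //; rewrite lt_neqAle (jet_N_le1 J u_ge0 bdry (subset_closure Dx)) andbT.
  exact/eqP.
have rho_ge0 : 0 <= rho by exact: sqrtr_ge0.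
have rho0 : 0 < rho.
  rewrite lt_neqAle rho_ge0 andbT eq_sym; apply/eqP => r0.
  have : sqdist x0 y <= 0 ^+ 2 by rewrite rhoE r0.
  move=> /(sqdist_coord (lexx 0))[].
  rewrite !normr_le0 !subr_eq0 => /eqP y1 /eqP y2.
  have E : y = x0 by rewrite (surjective_pairing y) y1 y2 -surjective_pairing.
  by have := Zy; rewrite /Z /= E => /(_ Dx0) N1; move: Nx0; rewrite N1 ltxx.
pose v := (x0.1 - y.1, x0.2 - y.2).
have yv : inward D y v.
  exists 1 => // t /andP[t0 t1]; apply: (dk _ _).1.
  have -> : sqdist x0 (y + t *: v) = (1 - t) ^+ 2 * rho ^+ 2.
    by rewrite -rhoE /sqdist /v /= /GRing.scale/=; ring.
  rewrite gtr_pMl ?exprn_gt0//.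
  by rewrite expr_lt1 ?subr_ge0 ?ltW// gtrBl.
have cy := inward_closure yv.
have [Ny [b1y b2y]] : N y = 1 /\ (b1 y = 0 /\ b2 y = 0).
  have [Dy|nDy] := pselect (D y); last by split; [exact: (bdry cy nDy).2|exact: b0].
  have Ny : N y = 1 by exact: Zy.
  have H w : w.1 * b1 y + w.2 * b2 y <= 0.
    by apply: (inward_N_le0 J u_ge0 bdry Ny); exact: (open_inward _ (jet_open J) Dy).
  split=> //; have := H (1, 0); have := H (-1, 0); have := H (0, 1); have := H (0, -1).
  by rewrite /=; split; lra.
exact: (hopf rho0 rhoE Ny dk b1y b2y).
Qed.

End BoundaryCurvature.

(** * Solutions with constant gradient *)

Section HalfPlanes.
Variable R : realType.
Variables (D : set (R * R)) (u p q r s a b : R * R -> R).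
Hypothesis J : harmonic_jet D u p q r s a b.
Hypothesis u_cont : continuous u.
Hypothesis u_pos : forall x, D x <-> 0 < u x.
Hypothesis u_zero : forall x, ~ D x -> u x = 0.
Hypothesis rs0 : forall x, D x -> r x = 0 /\ s x = 0.
Hypothesis N1 : forall x, D x -> p x ^+ 2 + q x ^+ 2 = 1.

Lemma affine_on_segment x0 v (T : R) : 0 < T ->
  (forall t, 0 <= t < T -> D (x0 + t *: v)) ->
  u (x0 + T *: v) = u x0 + T * (v.1 * p x0 + v.2 * q x0) /\
  (forall t, 0 <= t < T -> p (x0 + t *: v) = p x0 /\ q (x0 + t *: v) = q x0).
Proof.
move=> T0 TD.
have cst (f : R * R -> R) : (forall x, D x -> is_derive x v f 0) ->
    forall t, 0 <= t < T -> f (x0 + t *: v) = f x0.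
  move=> f0 t /andP[]; rewrite le_eqVlt => /predU1P[<- _|t0 tT].
    by rewrite scale0r addr0.
  have D' z : 0 <= z <= t -> is_derive z 1 (fun z => f (x0 + z *: v)) ((fun=> 0 : R) z).
    move=> /andP[z0 zt]; apply: is_derive_line; apply: f0; apply: TD.
    by rewrite z0 (le_lt_trans zt).
  have [||c _] := MVT (f := fun z => f (x0 + z *: v)) (df := fun=> 0) t0.
  - by move=> z; rewrite in_itv/= => /andP[z0 zt]; apply: D'; rewrite !ltW.
  - apply: derivable_within_continuous => z; rewrite in_itv/= => zt.
    by have [] := D' z zt.
  by rewrite scale0r addr0 mul0r => /eqP; rewrite subr_eq0 => /eqP.
have pE := cst p; have qE := cst q.
have {}pE t : 0 <= t < T -> p (x0 + t *: v) = p x0.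
  apply: pE => x Dx; have := jet_is_derive_p J v Dx.
  by have [-> ->] := rs0 Dx; rewrite !mulr0 addr0.
have {}qE t : 0 <= t < T -> q (x0 + t *: v) = q x0.
  apply: qE => x Dx; have := jet_is_derive_q J v Dx.
  by have [-> ->] := rs0 Dx; rewrite !mulr0 subr0.
split; last by move=> t tT; split; [exact: pE|exact: qE].
pose h z := u (x0 + z *: v).
have [||c] := MVT (f := h) (df := fun=> v.1 * p x0 + v.2 * q x0) T0.
- move=> z; rewrite in_itv/= => /andP[z0 zt].
  have zT : 0 <= z < T by rewrite ltW.
  rewrite -(pE z zT) -(qE z zT); apply: is_derive_line.
  by apply: (jet_is_derive_u J); exact: TD.
- apply: continuous_subspaceT => z; rewrite /h.
  exact: (continuous_comp (@line_continuous _ x0 v z) (@u_cont _)).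
by move=> _; rewrite /h scale0r addr0 subr0 => E; rewrite [T * _]mulrC -E; ring.
Qed.

(** On the segment from [x0] to [x], [u] is affine up to the first point where
    it vanishes; being positive at both ends, the affine function does not
    vanish in between, so there is no such point. *)
Lemma half_plane x0 x : D x0 ->
  0 < u x0 + ((x.1 - x0.1) * p x0 + (x.2 - x0.2) * q x0) ->
  [/\ D x, u x = u x0 + ((x.1 - x0.1) * p x0 + (x.2 - x0.2) * q x0),
      p x = p x0 & q x = q x0].
Proof.
move=> Dx0 Lx; pose v := x - x0.
have xE : x = x0 + 1 *: v by rewrite scale1r /v addrC subrK.
pose K := `[(0:R), 1]%classic `&` [set t : R | u (x0 + t *: v) <= 0].
have uc : continuous (fun t : R => u (x0 + t *: v)).
  by move=> t; exact: (continuous_comp (@line_continuous _ x0 v t) (@u_cont _)).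
have DK t : 0 <= t <= 1 -> ~ K t -> D (x0 + t *: v).
  move=> t01 nK; apply/u_pos; rewrite ltNge; apply/negP => ut; apply: nK.
  by split => //; rewrite /= in_itv.
have [[t Kt]|K0] := pselect (K !=set0); last first.
  have D1 t : 0 <= t <= 1 -> D (x0 + t *: v).
    by move=> t01; apply: DK => // Kt; apply: K0; exists t.
  have [|E _] := @affine_on_segment x0 v 1 ltr01.
    by move=> t /andP[t0 /ltW t1]; apply: D1; rewrite t0.
  have Dx : D x by rewrite xE; apply: D1; rewrite ler01 lexx.
  have [d d0 dD] := open_inward v (jet_open J) Dx.
  have [||_ H] := @affine_on_segment x0 v (1 + d / 2).
  - by rewrite addr_gt0// divr_gt0.
  - move=> t /andP[t0 td]; have [t1|t1] := leP t 1; first by apply: D1; rewrite t0.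
    have -> : x0 + t *: v = x + (t - 1) *: v.
      by rewrite [in RHS]xE -addrA -scalerDl addrCA subrr addr0.
    by apply: dD; apply/andP; split; lra.
  have [px qx] : p (x0 + 1 *: v) = p x0 /\ q (x0 + 1 *: v) = q x0.
    by apply: H; rewrite ler01 ltrDl divr_gt0.
  by rewrite -xE in E px qx; split => //; rewrite E mul1r.
have cK : compact K.
  apply: (@subclosed_compact _ _ `[(0:R), 1]%classic).
  - apply: closedI; first exact: interval_closed.
    rewrite (_ : [set t | _] = (fun t : R => u (x0 + t *: v)) @^-1` [set z | z <= 0])//.
    by apply: closed_comp => [z _|]; [exact: uc|exact: closed_le].
  - exact: segment_compact.
  - by move=> z [].
have [T /set_mem[]] := compact_EVT_min (f := id) (ex_intro _ t Kt) cK
  (continuous_subspaceT (fun z => cvg_id)).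
rewrite /= in_itv/= => /andP[T0 T1] uT Tmin.
have Tp : 0 < T.
  rewrite lt_neqAle T0 andbT eq_sym; apply/eqP => z.
  by move: uT; rewrite z scale0r addr0; rewrite leNgt (u_pos x0).1.
have [|E _] := @affine_on_segment x0 v T Tp.
  move=> z /andP[z0 zT]; apply: DK; first by rewrite z0 ltW// (lt_le_trans zT).
  move=> Kz; have := Tmin z; rewrite inE => /(_ Kz).
  by rewrite leNgt zT.
exfalso; move: uT; rewrite E; apply/negP; rewrite -ltNge.
have u0 := (u_pos x0).1 Dx0.
rewrite /v /=.
nra.
Qed.

(** The first order Taylor polynomial of [u] at [x0]. *)
Let L x0 x := x.1 * p x0 + x.2 * q x0 + (u x0 - x0.1 * p x0 - x0.2 * q x0).

Lemma half_plane_affine x0 x : D x0 -> 0 < L x0 x ->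
  [/\ D x, u x = L x0 x, p x = p x0, q x = q x0 & forall z, L x z = L x0 z].
Proof.
move=> Dx0 Lx; have E : L x0 x = u x0 + ((x.1 - x0.1) * p x0 + (x.2 - x0.2) * q x0).
  by rewrite /L; ring.
have Lx' := Lx; rewrite E in Lx'; have [Dx ux px qx] := half_plane Dx0 Lx'.
split => //; first by rewrite E.
by move=> z; rewrite /L px qx ux; ring.
Qed.

Lemma half_plane_self x0 : D x0 -> L x0 x0 = u x0.
Proof. by move=> Dx0; rewrite /L; ring. Qed.

(** Two half planes whose unit normals are not opposite intersect, in the
    direction of the sum of the normals. *)
Lemma disjoint_half_planes x0 x1 : D x0 -> D x1 -> L x0 x1 <= 0 ->
  [/\ p x1 = - p x0, q x1 = - q x0 &
      (u x0 - x0.1 * p x0 - x0.2 * q x0) + (u x1 - x1.1 * p x1 - x1.2 * q x1) <= 0].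
Proof.
move=> D0 D1 L01.
have dj x : 0 < L x0 x -> 0 < L x1 x -> False.
  move=> /(half_plane_affine D0)[_ _ _ _ E0] /(half_plane_affine D1)[_ _ _ _ E1].
  move: L01; rewrite -E0 E1 (half_plane_self D1) leNgt.
  by rewrite ((u_pos x1).1 D1).
have n0 := N1 D0; have n1 := N1 D1.
pose k0 := u x0 - x0.1 * p x0 - x0.2 * q x0.
pose k1 := u x1 - x1.1 * p x1 - x1.2 * q x1.
pose w := 1 + (p x0 * p x1 + q x0 * q x1).
have w0 : w <= 0.
  rewrite leNgt; apply/negP => w0.
  pose t := (`|k0| + `|k1| + 1) / w.
  have tw : t * w = `|k0| + `|k1| + 1 by rewrite divfK// gt_eqF.
  have h0 := ler_norm (- k0); have h1 := ler_norm (- k1).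
  rewrite !normrN in h0 h1.
  have a0 := normr_ge0 k0; have a1 := normr_ge0 k1.
  apply: (dj (t * (p x0 + p x1), t * (q x0 + q x1))).
    have -> : L x0 (t * (p x0 + p x1), t * (q x0 + q x1)) = t * w + k0.
      by rewrite /L /= -/k0 /w -n0; ring.
    lra.
  have -> : L x1 (t * (p x0 + p x1), t * (q x0 + q x1)) = t * w + k1.
    by rewrite /L /= -/k1 /w -n1; ring.
  lra.
have S : (p x0 + p x1) ^+ 2 + (q x0 + q x1) ^+ 2 = 2 * w.
  rewrite /w.
  have -> : (p x0 + p x1) ^+ 2 + (q x0 + q x1) ^+ 2 =
    (p x0 ^+ 2 + q x0 ^+ 2) + (p x1 ^+ 2 + q x1 ^+ 2) + 2 * (p x0 * p x1 + q x0 * q x1) by ring.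
  by rewrite n0 n1; ring.
have sp := sqr_ge0 (p x0 + p x1); have sq := sqr_ge0 (q x0 + q x1).
have /eqP : (p x0 + p x1) ^+ 2 = 0 by lra.
have /eqP : (q x0 + q x1) ^+ 2 = 0 by lra.
rewrite !sqrf_eq0 !addr_eq0 => /eqP qq /eqP pp.
have p1 : p x1 = - p x0 by rewrite pp opprK.
have q1 : q x1 = - q x0 by rewrite qq opprK.
split=> //; rewrite -/k0 -/k1 leNgt; apply/negP => k01.
pose t := (k1 - k0) / 2.
apply: (dj (t * p x0, t * q x0)).
  have -> : L x0 (t * p x0, t * q x0) = t * (p x0 ^+ 2 + q x0 ^+ 2) + k0.
    by rewrite /L /= -/k0; ring.
  by rewrite n0 /t; lra.
have -> : L x1 (t * p x0, t * q x0) = - t * (p x0 ^+ 2 + q x0 ^+ 2) + k1.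
  by rewrite /L /= -/k1 p1 q1; ring.
by rewrite n0 /t; lra.
Qed.

(** The hypothesis on [y] and [m] rules out two complementary half planes: the
    complement of [D] would be a line, which does not contain a segment in every
    direction of an open half plane. *)
Lemma one_or_two_planes x0 : D x0 ->
  (exists y m, 0 < m.1 ^+ 2 + m.2 ^+ 2 /\
     forall v, v.1 * m.1 + v.2 * m.2 < 0 -> inward (~` D) y v) ->
  exists2 T : R * R -> R * R, rigid_motion T &
    (forall x, u (T x) = pos_part x.2) \/
    (exists2 a : R, 0 < a &
      forall x, u (T x) = pos_part x.2 + neg_part (x.2 + a)).
Proof.
move=> D0 [y [m [m0 solid]]].
have n0 := N1 D0.
pose k0 := u x0 - x0.1 * p x0 - x0.2 * q x0.
pose T x : R * R := (x.1 * q x0 + (x.2 - k0) * p x0, - (x.1 * p x0) + (x.2 - k0) * q x0).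
have LT x : L x0 (T x) = x.2.
  have -> : L x0 (T x) = (x.2 - k0) * (p x0 ^+ 2 + q x0 ^+ 2) + k0.
    by rewrite /L /T /= -/k0; ring.
  by rewrite n0; ring.
exists T.
  move=> x z; rewrite /enorm; congr Num.sqrt; rewrite /T /=.
  rewrite -[RHS]mulr1 -n0; ring.
have uL x : 0 < L x0 x -> u x = L x0 x by move=> /(half_plane_affine D0)[].
have [[x1 [D1 L1]]|nD1] := pselect (exists x1, D x1 /\ L x0 x1 <= 0); last first.
  left => x; rewrite /pos_part; have [x2|x2] := ltP 0 x.2.
    by rewrite uL LT.
  rewrite u_zero// => DT; apply: nD1.
  by exists (T x); rewrite LT.
right; have [p1 q1 k01] := disjoint_half_planes D0 D1 L1.
pose k1 := u x1 - x1.1 * p x1 - x1.2 * q x1.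
pose c := - (k0 + k1).
have c_ge0 : 0 <= c by rewrite oppr_ge0.
have L1E x : L x1 x = - (L x0 x + c).
  by rewrite /L -/k0 -/k1 /c p1 q1; ring.
have uL1 x : 0 < L x1 x -> u x = L x1 x by move=> /(half_plane_affine D1)[].
have DL x : D x -> 0 < L x0 x \/ 0 < L x1 x.
  move=> Dx; have [l0|l0] := ltP 0 (L x0 x); [by left|right].
  have [//|l1] := ltP 0 (L x1 x).
  have [px qx _] := disjoint_half_planes D0 Dx l0.
  have [px' qx' _] := disjoint_half_planes D1 Dx l1.
  have pz : p x0 = 0 by lra.
  have qz : q x0 = 0 by lra.
  by move: n0; rewrite pz qz expr0n addr0 => /esym/eqP; rewrite oner_eq0.
have ua x : u (T x) = pos_part x.2 + neg_part (x.2 + c).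
  rewrite /pos_part /neg_part; have [x2|x2] := ltP 0 x.2.
    by rewrite uL LT// max_r ?addr0//; lra.
  have [x2'|x2'] := ltP 0 (- (x.2 + c)).
    by rewrite uL1 L1E LT// add0r.
  rewrite addr0 u_zero// => /DL[]; rewrite ?L1E LT => h; lra.
exists c => //; rewrite lt_neqAle c_ge0 andbT; apply/eqP => c0.
have off x : ~ D x -> L x0 x = 0.
  move=> nD; apply/eqP; rewrite eq_le !leNgt; apply/andP; split; apply/negP => h.
    by have [] := half_plane_affine D0 h.
  have : 0 < L x1 x by rewrite L1E -c0; lra.
  by move=> /(half_plane_affine D1)[].
(* If [c = 0], [L x0] vanishes off [D], hence along every vector [v] of an open
   half plane, hence its gradient is zero. *)
have Lv v : v.1 * m.1 + v.2 * m.2 < 0 -> exists t1 : R, 0 < t1 /\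
    forall t, 0 < t < t1 -> L x0 y + t * (v.1 * p x0 + v.2 * q x0) = 0.
  move=> /solid[t1 t10 tP]; exists t1; split => // t tt.
  by rewrite -(off _ (tP t tt)) /L /= /GRing.scale/=; ring.
have Lv0 v : v.1 * m.1 + v.2 * m.2 < 0 -> v.1 * p x0 + v.2 * q x0 = 0.
  move=> /Lv[t1 [t10 tP]].
  have := tP (t1 / 2); have := tP (t1 / 4).
  have h2 : 0 < t1 / 2 < t1 by apply/andP; split; lra.
  have h4 : 0 < t1 / 4 < t1 by apply/andP; split; lra.
  move=> /(_ h4) E4 /(_ h2) E2.
  have : t1 / 4 * (v.1 * p x0 + v.2 * q x0) = 0 by lra.
  by move=> /eqP; rewrite mulf_eq0 gt_eqF ?divr_gt0//= => /eqP.
have A : m.1 * p x0 + m.2 * q x0 = 0.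
  have h : - m.1 * m.1 + - m.2 * m.2 < 0 by move: m0; rewrite !expr2; lra.
  by have := Lv0 (- m.1, - m.2) h; rewrite /=; lra.
have B : - (m.2 * p x0) + m.1 * q x0 = 0.
  have h : (- m.1 - m.2) * m.1 + (- m.2 + m.1) * m.2 < 0.
    by move: m0; rewrite !expr2; lra.
  by have := Lv0 (- m.1 - m.2, - m.2 + m.1) h; rewrite /=; lra.
have : (m.1 ^+ 2 + m.2 ^+ 2) * (p x0 ^+ 2 + q x0 ^+ 2) = 0.
  have -> : (m.1 ^+ 2 + m.2 ^+ 2) * (p x0 ^+ 2 + q x0 ^+ 2) =
    (m.1 * p x0 + m.2 * q x0) ^+ 2 + (- (m.2 * p x0) + m.1 * q x0) ^+ 2 by ring.
  by rewrite A B expr0n addr0.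
by rewrite n0 mulr1; move: m0 => /[swap] ->; rewrite ltxx.
Qed.

End HalfPlanes.

(** * Smooth logarithmic cutoffs and their energy *)

Section FlatExponential.
Variable R : realType.

(** The functions [t ^- n * exp (- 1 / t)], extended by [0]: the derivatives of
    [flat 0] are linear combinations of them. *)
Definition flat (n : nat) (t : R) : R :=
  if 0 < t then t^-1 ^+ n * expR (- t^-1) else 0.

Lemma flat_le0 n t : t <= 0 -> flat n t = 0.
Proof. by rewrite /flat ltNge => ->. Qed.

Lemma flat_ge0 n t : 0 <= flat n t.
Proof.
rewrite /flat; case: ifPn => // t0.
by rewrite mulr_ge0 ?expR_ge0// exprn_ge0// invr_ge0 ltW.
Qed.

(** The exponential series dominates each of its terms. *)
Lemma flat_le_fact n t : flat n t <= n`!%:R.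
Proof.
rewrite /flat; case: ifPn => [t0|_]; last by rewrite ler0n.
rewrite expRN ler_pdivrMr ?expR_gt0//.
have s0 : 0 <= t^-1 by rewrite invr_ge0 ltW.
case: n => [|n]; first by rewrite expr0 fact0 mul1r -[leLHS]expR0 ler_expR.
have := expR_ge1Dxn n s0.
move=> h; have {}h : t^-1 ^+ n.+1 / n.+1`!%:R <= expR t^-1 by lra.
by rewrite mulrC -ler_pdivrMr// ltr0n fact_gt0.
Qed.

Lemma flatS n t : flat n t = t * flat n.+1 t.
Proof.
rewrite /flat; case: ifPn => [t0|_]; last by rewrite mulr0.
by rewrite exprS !mulrA mulfV ?mul1r// gt_eqF.
Qed.

Lemma is_derive_flat n (t : R) :
  is_derive t 1 (flat n) (flat n.+2 t - n%:R * flat n.+1 t).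
Proof.
have [t0|t0|<-] := ltgtP 0 t.
- have E : \forall z \near t, z^-1 ^+ n * expR (- z^-1) = flat n z.
    have /cvgr_gt : (fun z : R => z) z @[z --> t] --> t by exact: cvg_id.
    by move=> /(_ _ t0); apply: filterS => z z0; rewrite /flat z0.
  apply: near_eq_is_derive E _.
  have di : is_derive t 1 (fun z : R => z^-1) (- t^-1 ^+ 2 * 1).
    by apply: is_derive_invf; rewrite gt_eqF.
  have dn : is_derive t 1 (fun z : R => z^-1 ^+ n) (n%:R * t^-1 ^+ n.-1 * (- t^-1 ^+ 2 * 1)).
    have -> : (fun z : R => z^-1 ^+ n) = (fun z : R => z^-1) ^+ n.
      by apply/funext => z; rewrite exprfctE.
    exact: is_deriveX.
  have de : is_derive t 1 (fun z : R => expR (- z^-1)) (expR (- t^-1) * - (- t^-1 ^+ 2 * 1)).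
    by apply: is_derive_chain; exact: is_derive_oppf.
  apply: is_derive_eq (is_derive_mulf dn de) _.
  rewrite /flat t0; case: n {dn} => [|n] /=; first by rewrite !exprS expr0; ring.
  by rewrite !exprS; ring.
- have E : \forall z \near t, (fun=> 0 : R) z = flat n z.
    have /cvgr_lt : (fun z : R => z) z @[z --> t] --> t by exact: cvg_id.
    by move=> /(_ _ t0); apply: filterS => z z0; rewrite flat_le0// ltW.
  apply: near_eq_is_derive E _.
  rewrite !flat_le0 ?(ltW t0)// mulr0 subr0; exact: is_derive_cst.
- rewrite !flat_le0// mulr0 subr0.
  suff L : (fun h : R => h^-1 *: ((flat n \o shift 0) (h *: (1 : R)) - flat n 0)) @ 0^' --> (0 : R).
    by apply: DeriveDef; [apply/cvg_ex; eexists; exact: L | exact: cvg_lim].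
  apply/cvgrPdist_le => e e0.
  near=> h.
  have hn0 : h != 0 by near: h; exact: nbhs_dnbhs_neq.
  have hk : `|h| < e / (n.+2`!%:R) by near: h; apply: dnbhs0_lt; rewrite divr_gt0// ltr0n fact_gt0.
  rewrite /= addr0 [h *: 1]mulr1 (flat_le0 n (lexx 0)) subr0 sub0r normrN.
  rewrite flatS flatS [_ *: _]mulrA mulVf// mul1r normrM (ger0_norm (flat_ge0 _ _)).
  move: hk; rewrite ltr_pdivlMr ?ltr0n ?fact_gt0// => /ltW; apply: le_trans.
  by rewrite ler_wpM2l// flat_le_fact.
Unshelve. all: by end_near. Qed.

Lemma flat_continuous n : continuous (flat n).
Proof.
move=> t; apply: differentiable_continuous; apply/derivable1_diffP.
by have [] := is_derive_flat n t.
Qed.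

Lemma flat0_ge t : 1 / 2 <= t -> expR (- 2) <= flat 0 t.
Proof.
move=> t2; have t0 : 0 < t by lra.
rewrite /flat t0 expr0 mul1r ler_expR lerN2.
by rewrite -[leRHS]invrK lef_pV2 ?posrE//; lra.
Qed.

End FlatExponential.

Section LogCutoff.
Variable R : realType.
Variables (y : R * R) (ep : R).

Let logd x := ln (1 + sqdist y x).
Let invd x := (1 + sqdist y x)^-1.

Let d0 x : 0 < 1 + sqdist y x.
Proof. by rewrite ltr_pwDl// sqdist_ge0. Qed.

(** An algebra of functions closed under partial derivatives that contains the
    logarithmic cutoff [flat 0 (1 - ep * ln (1 + |x - y| ^ 2))]. *)
Inductive log_class : (R * R -> R) -> Prop :=
| log_class_cst c : log_class (fun=> c)
| log_class_fst : log_class (fun x => x.1 - y.1)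
| log_class_snd : log_class (fun x => x.2 - y.2)
| log_class_inv : log_class invd
| log_class_flat n : log_class (fun x => flat n (1 - ep * logd x))
| log_class_add f g : log_class f -> log_class g -> log_class (fun x => f x + g x)
| log_class_mul f g : log_class f -> log_class g -> log_class (fun x => f x * g x).

Let X (i : bool) (x : R * R) := if i then x.2 - y.2 else x.1 - y.1.

Let X_class i : log_class (X i).
Proof. by case: i; [exact: log_class_snd|exact: log_class_fst]. Qed.

Let is_derive_sqdist x i : is_derive x (basis_vector R i) (fun z => 1 + sqdist y z) (2 * X i x).
Proof. by case: i; rewrite /sqdist; derive_eq; rewrite /X /=; ring. Qed.

Lemma is_derive_flat_log n x i : is_derive x (basis_vector R i)
  (fun x => flat n (1 - ep * logd x))
  ((flat n.+2 (1 - ep * logd x) - n%:R * flat n.+1 (1 - ep * logd x)) *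
   (- (2 * ep) * (invd x * X i x))).
Proof.
apply: is_derive_chain (is_derive_flat n _).
have dl : is_derive x (basis_vector R i) logd ((1 + sqdist y x)^-1 * (2 * X i x)).
  by apply: is_derive_chain (is_derive_sqdist x i) _; exact: is_derive1_ln.
by derive_eq; rewrite /invd; ring.
Qed.

Lemma log_class_derive f i : log_class f -> exists2 g, log_class g &
  forall x, is_derive x (basis_vector R i) f (g x).
Proof.
elim => {f} [c||||n|f g cf [f' cf' df] cg [g' cg' dg]|f g cf [f' cf' df] cg [g' cg' dg]].
- by exists (fun=> 0); [exact: log_class_cst|move=> x; exact: is_derive_cst].
- exists (fun=> (basis_vector R i).1); first exact: log_class_cst.
  by move=> x; derive_eq; ring.
- exists (fun=> (basis_vector R i).2); first exact: log_class_cst.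
  by move=> x; derive_eq; ring.
- exists (fun x => - 2 * (invd x * (invd x * X i x))).
    by do ?[apply: log_class_mul]; by [exact: log_class_cst|exact: log_class_inv|exact: X_class].
  move=> x; have dd := is_derive_sqdist x i.
  have nz : 1 + sqdist y x != 0 by rewrite gt_eqF.
  apply: (is_derive_eq (is_derive_invf (f := fun z => 1 + sqdist y z) (x := x) nz dd)).
  by rewrite /invd; ring.
- exists (fun x => (flat n.+2 (1 - ep * logd x) + (- n%:R) * flat n.+1 (1 - ep * logd x)) *
     (- (2 * ep) * (invd x * X i x))).
    apply: log_class_mul.
      apply: log_class_add; first exact: log_class_flat.
      by apply: log_class_mul; [exact: log_class_cst|exact: log_class_flat].
    apply: log_class_mul; first exact: log_class_cst.
    by apply: log_class_mul; [exact: log_class_inv|exact: X_class].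
  by move=> x; rewrite mulNr; exact: is_derive_flat_log.
- exists (fun x => f' x + g' x); first exact: log_class_add.
  by move=> x; exact: is_derive_addf.
- exists (fun x => f' x * g x + f x * g' x).
    by apply: log_class_add; exact: log_class_mul.
  by move=> x; exact: is_derive_mulf.
Qed.

Lemma log_class_continuous f : log_class f -> continuous f.
Proof.
have cd : continuous (fun z => 1 + sqdist y z).
  by move=> x; apply: cvgD; [exact: cvg_cst|exact: sqdist_continuous].
elim => {f} [c||||n|f g _ cf _ cg|f g _ cf _ cg] x.
- exact: cvg_cst.
- by apply: cvgB; [exact: fst_continuous|exact: cvg_cst].
- by apply: cvgB; [exact: snd_continuous|exact: cvg_cst].
- by apply: cvgV; [rewrite gt_eqF|exact: cd].
- apply: (@continuous_comp _ _ _ (fun x => 1 - ep * logd x) (@flat R n)); last exact: flat_continuous.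
  apply: cvgB; first exact: cvg_cst.
  apply: cvgM; first exact: cvg_cst.
  exact: (@continuous_comp _ _ _ (fun x => 1 + sqdist y x) (@ln R) x (cd x) (continuous_ln (d0 x))).
- by apply: cvgD; [exact: cf|exact: cg].
- by apply: cvgM; [exact: cf|exact: cg].
Qed.

Lemma log_class_smooth f : log_class f -> smooth_in setT f.
Proof.
move=> cf w x _; have : log_class (partials w f).
  elim: w => [//|i w IH] /=; have [g cg dg] := log_class_derive i IH.
  suff -> : partial i (partials w f) = g by [].
  by apply/funext => z; have [_ <-] := dg z.
move=> cw; split; first exact: log_class_continuous.
by move=> i; have [g _ dg] := log_class_derive i cw; have [] := dg x.
Qed.

Definition log_cutoff x : R := flat 0 (1 - ep * ln (1 + sqdist y x)).

Hypothesis ep0 : 0 < ep.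

Lemma log_cutoff_outside n x : expR (ep^-1) <= 1 + sqdist y x ->
  flat n (1 - ep * ln (1 + sqdist y x)) = 0.
Proof.
move=> h; apply: flat_le0; rewrite subr_le0 -ler_pdivrMl// mulr1.
by rewrite -[leLHS]expRK ler_ln// posrE// expR_gt0.
Qed.

Lemma log_cutoff_test : test_function log_cutoff.
Proof.
split; first exact/log_class_smooth/(log_class_flat 0).
have cK := @compact_disk R setT y (Num.sqrt (expR (ep^-1))) (sqrtr_ge0 _) closedT.
apply: (subclosed_compact (@closed_closure _ _) cK).
have cl := compact_closed (@norm_hausdorff _ _) cK.
rewrite [X in _ `<=` X]((closure_id _).1 cl).
apply: closure_subset => x /= nz; split => //=.
rewrite sqr_sqrtr ?expR_ge0// leNgt; apply/negP => h.
move: nz; rewrite /log_cutoff log_cutoff_outside ?eqxx//.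
by rewrite (le_trans (ltW h))// lerDr.
Qed.

Lemma log_cutoff_gradient x : enorm (gradient log_cutoff x) ^+ 2 =
  4 * ep ^+ 2 * flat 2 (1 - ep * ln (1 + sqdist y x)) ^+ 2 *
  (sqdist y x / (1 + sqdist y x) ^+ 2).
Proof.
have D i : partial i log_cutoff x = flat 2 (1 - ep * logd x) * (- (2 * ep) * (invd x * X i x)).
  have [_ E] := is_derive_flat_log 0 x i.
  by rewrite /partial [LHS]E mul0r subr0.
rewrite enorm_sqr /gradient /= !D /X /invd /sqdist.
by rewrite -exprVn; ring.
Qed.

End LogCutoff.

Section UnmeasurableMonotonicity.
Context d (T : measurableType d) (R : realType).
Variable mu : {measure set T -> \bar R}.
Local Open Scope ereal_scope.

(** The integral of a nonnegative function is a supremum over the simple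
    functions below it, so that it is monotone without measurability. *)
Lemma ge0_le_integral_sup (A B : set T) (f g : T -> \bar R) :
  (forall x, A x -> 0 <= f x) -> (forall x, B x -> 0 <= g x) ->
  (forall x, (f \_ A) x <= (g \_ B) x) ->
  \int[mu]_(x in A) f x <= \int[mu]_(x in B) g x.
Proof.
move=> f0 g0 fg; rewrite !ge0_integralE//.
apply: ge_ereal_sup => _ [h /= hf <-]; apply: ereal_sup_ubound.
by exists h => //= x; exact: le_trans (hf x) (fg x).
Qed.

End UnmeasurableMonotonicity.

Section Energy.
Variable R : realType.
Variable y : R * R.

Definition square (k : nat) : set (R * R) :=
  `[y.1 - 2 ^+ k, y.1 + 2 ^+ k]%classic `*` `[y.2 - 2 ^+ k, y.2 + 2 ^+ k]%classic.

Lemma measurable_square k :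
  measurable (square k : set (measurableTypeR R * measurableTypeR R)).
Proof. by apply: measurableX; exact: measurable_itv. Qed.

Lemma lebesgue_measure2_square k :
  lebesgue_measure2 R (square k) = (4 * 4 ^+ k)%:E.
Proof.
pose I (c : R) : set (measurableTypeR R) := `[c - 2 ^+ k, c + 2 ^+ k]%classic.
have -> : lebesgue_measure2 R (square k) =
    (lebesgue_measure (I y.1) * lebesgue_measure (I y.2))%E.
  by apply: product_measure1E; exact: measurable_itv.
rewrite /I !lebesgue_measure_itv /= !lte_fin.
have k0 : 0 < 2 ^+ k :> R by rewrite exprn_gt0.
have -> : y.1 - 2 ^+ k < y.1 + 2 ^+ k by lra.
have -> : y.2 - 2 ^+ k < y.2 + 2 ^+ k by lra.
rewrite -!EFinB -EFinM; congr EFin.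
have -> : 4 ^+ k = 2 ^+ k * 2 ^+ k :> R by rewrite -exprMn; congr (_ ^+ k); ring.
by ring.
Qed.

(** In the annulus between the circles of radii [2 ^ k.-1] and [2 ^ k], the
    [k]-th term alone dominates. *)
Lemma dyadic_bound N x : sqdist y x <= 4 ^+ N ->
  (1 + sqdist y x)^-1 <= \sum_(k < N.+1) 4 / 4 ^+ k * \1_(square k) x.
Proof.
have sq k : sqdist y x <= 4 ^+ k -> \1_(square k) x = 1 :> R.
  move=> h; rewrite indicE mem_set//.
  have [||] := @sqdist_coord _ y x (2 ^+ k).
  - by rewrite exprn_ge0.
  - by rewrite -exprM mulnC exprM (_ : 2 ^+ 2 = 4 :> R)//; ring.
  rewrite !ler_norml => /andP[a1 a2] /andP[b1 b2].
  by split; rewrite /= in_itv/=; apply/andP; split; lra.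
have S0 := sqdist_ge0 y x.
have S1 : 0 < 1 + sqdist y x by rewrite ltr_pwDl.
elim: N => [|N IH] h.
  rewrite big_ord_recl big_ord0 addr0 /= sq// mulr1 expr0 divr1.
  by rewrite invf_ple ?posrE//; lra.
have term0 k : 0 <= 4 / 4 ^+ k * \1_(square k) x :> R.
  by rewrite mulr_ge0// divr_ge0// exprn_ge0.
rewrite big_ord_recr /=.
have [h'|h'] := leP (sqdist y x) (4 ^+ N); first by rewrite (le_trans (IH h'))// lerDl.
rewrite sq// mulr1 exprS invfM mulrA mulfV// mul1r.
apply: le_trans (_ : _ <= (4 ^+ N)^-1) _; last first.
  by rewrite lerDr sumr_ge0.
by rewrite lef_pV2 ?posrE ?exprn_gt0//; lra.
Qed.

(** The squared gradient is at most [16 * ep ^ 2 / (1 + |x - y| ^ 2)] on the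
    disk of radius [2 ^ N] and vanishes outside, and each of the [N.+1] dyadic
    scales contributes the same amount to its integral; since [N] is of order
    [1 / ep], the energy is of order [ep]. *)
Lemma log_cutoff_energy (A : set (R * R)) (ep : R) N : 0 < ep ->
  expR (ep^-1) = 4 ^+ N ->
  (\int[lebesgue_measure2 R]_(x in A)
     (enorm (gradient (log_cutoff y ep) x) ^+ 2)%:E <=
   (256 * ep ^+ 2 * N.+1%:R)%:E)%E.
Proof.
move=> ep0 epN.
pose g (x : measurableTypeR R * measurableTypeR R) : R :=
  \sum_(k < N.+1) (64 * ep ^+ 2 / 4 ^+ k * \1_(square k) x).
have g0 x : 0 <= g x.
  apply: sumr_ge0 => k _.
  by rewrite mulr_ge0// divr_ge0 ?exprn_ge0// mulr_ge0// sqr_ge0.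
have gle x : enorm (gradient (log_cutoff y ep) x) ^+ 2 <= g x.
  rewrite log_cutoff_gradient.
  have [h|h] := leP (expR ep^-1) (1 + sqdist y x).
    by rewrite log_cutoff_outside// expr0n mulr0 mul0r.
  have S0 := sqdist_ge0 y x.
  have S1 : 0 < 1 + sqdist y x by rewrite ltr_pwDl.
  have hN : sqdist y x <= 4 ^+ N by rewrite -epN; lra.
  set F := flat 2 _.
  have F4 : F ^+ 2 <= 4.
    rewrite (_ : 4 = 2 ^+ 2); last by ring.
    by rewrite ler_sqr ?nnegrE ?flat_ge0//; exact: (flat_le_fact 2).
  have Q : sqdist y x / (1 + sqdist y x) ^+ 2 <= (1 + sqdist y x)^-1.
    by rewrite expr2 invfM mulrA ger_pMl ?invr_gt0// ler_pdivrMr// mul1r lerDr.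
  have Q0 : 0 <= sqdist y x / (1 + sqdist y x) ^+ 2 by rewrite divr_ge0// exprn_ge0// ltW.
  have ep2 : 0 <= ep ^+ 2 by rewrite sqr_ge0.
  apply: le_trans (_ : _ <= 16 * ep ^+ 2 * (1 + sqdist y x)^-1) _.
    apply: ler_pM => //; first by rewrite mulr_ge0 ?sqr_ge0// mulr_ge0.
    have := ler_wpM2l ep2 F4; lra.
  apply: le_trans (ler_wpM2l _ (dyadic_bound hN)) _; first by rewrite mulr_ge0.
  rewrite mulr_sumr /g le_eqVlt; apply/orP; left; apply/eqP.
  by apply: eq_bigr => k _; ring.
apply: le_trans (_ : _ <= \int[lebesgue_measure2 R]_x (g x)%:E)%E _.
  apply: ge0_le_integral_sup => [x _|x _|x].
  - by rewrite lee_fin sqr_ge0.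
  - by rewrite lee_fin.
  - by rewrite patch_setT patchE; case: ifP => _; rewrite lee_fin.
rewrite /g.
under eq_integral do rewrite -sumEFin.
rewrite ge0_integral_sum//=.
- have term (k : 'I_N.+1) : (\int[lebesgue_measure2 R]_x (64 * ep ^+ 2 / 4 ^+ k * \1_(square k) x)%:E
      = (256 * ep ^+ 2)%:E)%E.
    under eq_integral do rewrite EFinM.
    rewrite ge0_integralZl_EFin//=.
    + rewrite integral_indic//=; last exact: measurable_square.
      rewrite setIT lebesgue_measure2_square -EFinM; congr EFin.
      by field; rewrite expf_neq0.
    + by apply/measurable_EFinP; apply: measurable_indic; exact: measurable_square.
    + by rewrite divr_ge0 ?exprn_ge0// mulr_ge0// sqr_ge0.
  rewrite (eq_bigr (fun=> (256 * ep ^+ 2)%:E)); last by move=> k _; exact: term.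
  by rewrite sumEFin sumr_const card_ord lee_fin mulr_natr.
- move=> k; apply/measurable_EFinP; apply: measurable_funM => //.
  by apply: measurable_indic; exact: measurable_square.
- move=> k x _; rewrite lee_fin mulr_ge0// divr_ge0 ?exprn_ge0// mulr_ge0// sqr_ge0.
Unshelve. all: by []. Qed.

End Energy.

(** * The one-dimensional Hausdorff measure *)

Section HausdorffBorel.
Variable R : realType.
Implicit Types (A B C X : set (R * R)).
Local Open Scope ereal_scope.

Lemma enorm_le_diam A x y : A x -> A y -> (enorm (x - y))%:E <= diam A.
Proof. by move=> Ax Ay; apply: ereal_sup_ubound; right; exists x => //; exists y. Qed.

Lemma hausdorff1_content_anti A (d e : R) : (d <= e)%R ->
  hausdorff1_content e A <= hausdorff1_content d A.
Proof.
move=> de; apply/ereal_inf_le_tmp => _ [C [AC dC] <-].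
by exists C => //; split => // k; rewrite (le_trans (dC k))// lee_fin.
Qed.

(** In a cover by sets of diameter at most [e], none of them meets both [A] and
    [B], so the cover splits into a cover of [A] and a cover of [B]. *)
Lemma hausdorff1_content_separated A B (d e : R) : (e < d)%R ->
  (forall x y, A x -> B y -> (d <= enorm (x - y))%R) ->
  hausdorff1_content e A + hausdorff1_content e B <=
  hausdorff1_content e (A `|` B).
Proof.
move=> ed AB; apply: le_ereal_inf_tmp => _ [C [ABC dC] <-].
pose CA (S : set (R * R)) k := if pselect (C k `&` S !=set0) then C k else set0.
have cov S : S `<=` A `|` B -> hausdorff1_content e S <= \sum_(k <oo) diam (CA S k).
  move=> SAB; apply: ereal_inf_lbound; exists (CA S) => //; split.
    move=> x Sx; have [k _ Ck] := ABC x (SAB x Sx).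
    by exists k => //; rewrite /CA; case: pselect => // h; case: h; exists x.
  move=> k; rewrite /CA; case: pselect => ? /=; first exact: dC.
  by rewrite diam0 (le_trans (diam_ge0 (C k))).
apply: le_trans (leeD (cov A (@subsetUl _ _ _)) (cov B (@subsetUr _ _ _))) _.
rewrite -nneseriesD; try by move=> *; exact: diam_ge0.
apply: lee_nneseries => k _; first by move=> _; rewrite adde_ge0 ?diam_ge0.
rewrite /CA; case: pselect => [[x [Cx Ax]]|?]; case: pselect => [[y [Cy By]]|?] /=;
  rewrite ?diam0 ?adde0 ?add0e ?diam_ge0//.
exfalso; have := le_trans (enorm_le_diam Cx Cy) (dC k).
by rewrite lee_fin leNgt (lt_le_trans ed)// AB.
Qed.

(** Only the covers by sets of diameter less than [d] matter in the limit. *)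
Lemma hausdorff1_separated A B (d : R) : (0 < d)%R ->
  (forall x y, A x -> B y -> (d <= enorm (x - y))%R) ->
  hausdorff1 A + hausdorff1 B <= hausdorff1 (A `|` B).
Proof.
move=> d0 AB; have [->|oo] := eqVneq (hausdorff1 (A `|` B)) +oo; first by rewrite leey.
have fin S : S `<=` A `|` B -> hausdorff1 S \is a fin_num.
  move=> SAB; rewrite ge0_fin_numE ?hausdorff1_ge0//.
  by rewrite (le_lt_trans (le_hausdorff1 SAB))// ltey.
have finc S e : (0 < e)%R -> S `<=` A `|` B -> hausdorff1_content e S \is a fin_num.
  move=> e0 SAB; rewrite ge0_fin_numE ?hausdorff1_content_ge0//.
  by rewrite (le_lt_trans (hausdorff1_content_le _ e0))// ltey_eq fin.
have fB := fin B (@subsetUr _ _ _).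
rewrite -leeBrDr//; apply: ge_ereal_sup => _ [e1 /= e10 <-].
have fA := finc A e1 e10 (@subsetUl _ _ _).
rewrite leeBrDr// addeC -leeBrDr//; apply: ge_ereal_sup => _ [e2 /= e20 <-].
rewrite leeBrDr//.
pose e : R := Num.min (Num.min e1 e2) (d / 2)%R.
have e0 : (0 < e)%R by rewrite !lt_min e10 e20 divr_gt0.
have ed : (e < d)%R by rewrite gt_min; apply/orP; right; lra.
apply: le_trans (hausdorff1_content_le _ e0).
apply: le_trans (hausdorff1_content_separated ed AB).
rewrite addeC; apply: leeD; apply: hausdorff1_content_anti.
  by rewrite !ge_min lexx.
by rewrite !ge_min lexx orbT.
Qed.

(** Caratheodory's criterion: the layers [L k.+1 `\` L k] around [C] are
    separated from [L k.-1], which makes the series of their measures converge. *)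
Lemma closed_caratheodory C : closed C ->
  (hausdorff1_outer R).-caratheodory C.
Proof.
move=> cC; apply: le_caratheodory_measurable => X.
change (hausdorff1 (X `&` C) + hausdorff1 (X `&` ~` C) <= hausdorff1 X).
have [->|oo] := eqVneq (hausdorff1 X) +oo; first by rewrite leey.
have Xoo : hausdorff1 X < +oo by rewrite ltey.
pose L n : set (R * R) := [set x | X x /\ forall c, C c -> (n.+1%:R^-1 <= enorm (x - c))%R].
have LX n : L n `<=` X by move=> x [].
have LS n : L n `<=` L n.+1.
  move=> x [Xx Lx]; split => // c Cc; apply: le_trans (Lx c Cc).
  by rewrite lef_pV2 ?posrE ?ltr0n// ler_nat.
have inv_lt n : (n.+2%:R^-1 < n.+1%:R^-1 :> R)%R.
  by rewrite ltf_pV2 ?posrE ?ltr0n// ltr_nat.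
pose D n := L n.+1 `\` L n.
have sepL n : hausdorff1 (L n) + hausdorff1 (D n.+1) <= hausdorff1 (L n.+2).
  apply: le_trans (_ : _ <= hausdorff1 (L n `|` D n.+1)) _; last first.
    apply: le_hausdorff1 => x [/LS/LS//|[]//].
  apply: (@hausdorff1_separated _ _ (n.+1%:R^-1 - n.+2%:R^-1)%R).
    by rewrite subr_gt0.
  move=> x z [Xx Lx] [[Xz _] nLz].
  have [c [Cc zc]] : exists c, C c /\ (enorm (z - c) < n.+2%:R^-1)%R.
    apply: contrapT => h; apply: nLz; split => // c Cc.
    by rewrite leNgt; apply/negP => zc; apply: h; exists c.
  have := enorm_triangle (x - z)%R (z - c)%R.
  rewrite addrA subrK => xc.
  rewrite lerBlDr; apply: le_trans (Lx c Cc) (le_trans xc _).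
  by rewrite lerD2l ltW.
have sumD m : \sum_(0 <= k < m) hausdorff1 (D k.+1) <= hausdorff1 (L m.+1) + hausdorff1 (L m).
  elim: m => [|m IH]; first by rewrite big_nil adde_ge0 ?hausdorff1_ge0.
  rewrite big_nat_recr//=; apply: le_trans (leeD IH (lexx _)) _.
  by rewrite -addeA [leRHS]addeC leeD2l// sepL.
have sumoo : \sum_(0 <= k <oo) hausdorff1 (D k.+1) < +oo.
  apply: le_lt_trans (_ : _ <= hausdorff1 X + hausdorff1 X) _; last first.
    by rewrite lte_add_pinfty.
  apply: lime_le; first by apply: is_cvg_nneseries => k _ _; exact: hausdorff1_ge0.
  near=> m; apply: le_trans (sumD m) _.
  by apply: leeD; apply: le_hausdorff1.
have tail := nneseries_tail_cvg sumoo (fun k _ => hausdorff1_ge0 (D k.+1)).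
apply/lee_addgt0Pr => e e0.
have [N _ /(_ N (leqnn N))] : \forall N \near \oo, \sum_(N <= k <oo) hausdorff1 (D k.+1) < e%:E.
  have e0' : 0 < e%:E by rewrite lte_fin.
  exact: (tail _ (open_ereal_lt' e0')).
rewrite /= => tailN.
have out : X `&` ~` C `<=` L N `|` D N `|` \bigcup_(n in ~` `I_N) D n.+1.
  move=> x [Xx nCx].
  have [n Ln] : exists n, L n x.
    have : nbhs x (~` C) by apply: open_nbhs_nbhs; split => //; exact: closed_openC.
    move=> /near_square[d d0 dC].
    have [n nd] : exists n, (n.+1%:R^-1 < d)%R.
      exists (Num.truncn d^-1); rewrite invf_plt ?posrE ?ltr0n//; exact: truncnS_gt.
    exists n; split => // c Cc; rewrite leNgt; apply/negP => xc.
    have xcd := lt_trans xc nd.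
    have e1 := @enorm_coord R (x - c)%R (1, 0)%R.
    have e2 := @enorm_coord R (x - c)%R (0, 1)%R.
    apply: (dC c) => //.
      rewrite distrC; apply: le_lt_trans xcd; move: e1; rewrite /= mulr1 mulr0 addr0; apply.
      by rewrite /enorm /= expr1n expr0n addr0 sqrtr1.
    rewrite distrC; apply: le_lt_trans xcd; move: e2; rewrite /= mulr1 mulr0 add0r; apply.
    by rewrite /enorm /= expr1n expr0n add0r sqrtr1.
  have [lN|gN] := pselect (L N x); first by left; left.
  have [lN1|gN1] := pselect (L N.+1 x); first by left; right.
  right; elim: n Ln => [|n IH] Ln.
    exfalso; apply: gN; elim: (N) => [//|m]; exact: LS.
  have [/IH//|nLn] := pselect (L n x).
  have Nn : (N.+1 <= n)%N.
    rewrite leqNgt; apply/negP => nN; apply: gN1.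
    have H m k : (m <= k)%N -> L m x -> L k x.
      by move=> /subnKC <-; elim: (k - m)%N => [|j IHj]; rewrite ?addn0 ?addnS// => /IHj/LS.
    exact: H nN Ln.
  exists n.-1.
    by apply/negP; rewrite -leqNgt -ltnS prednK// (leq_ltn_trans _ Nn).
  by rewrite prednK// (leq_ltn_trans _ Nn).
have sep2 : hausdorff1 (X `&` C) + hausdorff1 (L N.+1) <= hausdorff1 X.
  apply: le_trans (_ : _ <= hausdorff1 ((X `&` C) `|` L N.+1)) _; last first.
    by apply: le_hausdorff1 => x [[]|[]].
  apply: (@hausdorff1_separated _ _ N.+2%:R^-1%R); first by rewrite invr_gt0 ltr0n.
  by move=> x z [_ Cx] [_ /(_ x Cx)]; rewrite -opprB enormN.
have out2 : hausdorff1 (X `&` ~` C) <= hausdorff1 (L N.+1) + e%:E.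
  apply: le_trans (le_hausdorff1 out) _.
  have U2 := outer_measureU2 (hausdorff1_outer R).
  apply: le_trans (U2 (L N `|` D N) (\bigcup_(n in ~` `I_N) D n.+1)) _.
  apply: leeD.
    by apply: le_hausdorff1 => x [/LS//|[]].
  apply: le_trans (ltW tailN).
  exact: (outer_measure_sigma_subadditive_tail (hausdorff1_outer R) N (fun n => D n.+1)).
apply: le_trans (leeD (lexx _) out2) _.
by rewrite addeA leeD2r.
Unshelve. all: by end_near. Qed.

End HausdorffBorel.

Section Projection.
Variable R : realType.

(** Orthogonal projections to a line do not increase diameters; the factor two
    comes from covering a set by an interval around one of its points. *)
Lemma hausdorff1_projection (A : set (R * R)) (y tau : R * R) (l : R) :
  enorm tau = 1 -> 0 < l ->
  (forall z, 0 <= z <= l -> exists2 x, A x &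
     (x.1 - y.1) * tau.1 + (x.2 - y.2) * tau.2 = z) ->
  ((l / 2)%:E <= hausdorff1 A)%E.
Proof.
move=> t1 l0 proj; apply: le_trans (hausdorff1_content_le A ltr01).
apply: le_ereal_inf_tmp => _ [C [AC dC] <-].
pose pr (x : R * R) := (x.1 - y.1) * tau.1 + (x.2 - y.2) * tau.2.
pose d k := fine (diam (C k)).
have dE k : diam (C k) = (d k)%:E.
  rewrite fineK// ge0_fin_numE ?diam_ge0//.
  by rewrite (le_lt_trans (dC k))// ltry.
have d0 k : 0 <= d k by rewrite -lee_fin -dE diam_ge0.
pose I k : set (measurableTypeR R) := if pselect (C k !=set0)
  then `[pr (xget y (C k)) - d k, pr (xget y (C k)) + d k]%classic else set0.
have mI k : measurable (I k).
  by rewrite /I; case: pselect => ? /=; [exact: measurable_itv|exact: measurable0].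
have cov : (`[0, l]%classic : set (measurableTypeR R)) `<=` \bigcup_k I k.
  move=> z; rewrite /= in_itv/= => /proj[x Ax xz].
  have [k _ Cx] := AC x Ax; exists k => //; rewrite /I.
  case: pselect => [h|h] /=; last by apply: h; exists x.
  set x' := xget _ _; have Cx' : C k x' by apply: xgetPex.
  have := enorm_le_diam Cx Cx'; rewrite dE lee_fin => xx'.
  have := le_trans (enorm_coord (x - x') t1) xx'.
  rewrite in_itv/= ler_norml /= => /andP[h1 h2].
  by rewrite -xz /pr; apply/andP; split; lra.
have le2 k : (lebesgue_measure (I k) <= 2%:E * diam (C k))%E.
  rewrite /I dE; case: pselect => ? /=; last by rewrite measure0 -EFinM lee_fin mulr_ge0.
  rewrite lebesgue_measure_itv /= lte_fin; case: ifPn => _; last by rewrite -EFinM lee_fin mulr_ge0.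
  by rewrite -EFinB -EFinM lee_fin; lra.
have : (lebesgue_measure (`[0%R, l]%classic : set R) <= \sum_(k <oo) lebesgue_measure (I k))%E.
  by apply: measure_sigma_subadditive => //; exact: measurable_itv.
rewrite lebesgue_measure_itv /= lte_fin l0 sube0 => H.
have {}H : (l%:E <= 2%:E * \sum_(k <oo) diam (C k))%E.
  rewrite -nneseriesZl; last by move=> *; exact: diam_ge0.
  by apply: le_trans H _; apply: lee_nneseries.
rewrite -(@lee_pmul2l _ 2%:E)// -EFinM.
by have -> : 2 * (l / 2) = l by field.
Qed.

(** The projection recovers the abscissa of a point of the graph; the continuity
    of [g] at [0] keeps that point in the disk. *)
Lemma graph_projection (U : R * R -> R) y (rho : R) : 0 < rho ->
  smooth_free_boundary U -> free_boundary U y ->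
  exists tau l, [/\ enorm tau = 1, 0 < l &
    forall z, 0 <= z <= l -> exists2 x, (free_boundary U `&` [set x | sqdist y x <= rho ^+ 2]) x &
     (x.1 - y.1) * tau.1 + (x.2 - y.2) * tau.2 = z].
Proof.
move=> rho0 sF Fy; have [nu [d [eps [g [nu1 d0 eps0 gs P]]]]] := sF y Fy.
have nn : nu.1 ^+ 2 + nu.2 ^+ 2 = 1 by rewrite -enorm_sqr nu1 expr1n.
have g0 : g 0 = 0.
  have := P 0 0; rewrite !normr0 => /(_ d0 eps0)[[+ _] _ _].
  by rewrite !scale0r !addr0 => /(_ Fy).
have gc : {for 0, continuous g}.
  have := gs 0 0; rewrite normr0 => /(_ d0) dg.
  exact/differentiable_continuous/derivable1_diffP.
have e0 : 0 < Num.min eps (rho / 2) by rewrite lt_min eps0 divr_gt0.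
have /cvgrPdist_lt/(_ _ e0)/nbhs_ballP[d1 /= d10 gd] : g z @[z --> 0] --> g 0 := gc.
pose m := Num.min (Num.min d d1) (rho / 2).
have m0 : 0 < m by rewrite !lt_min d0 d10 divr_gt0.
exists (nu.2, - nu.1), (m / 2); split.
- by rewrite /enorm /= sqrrN addrC nn sqrtr1.
- by rewrite divr_gt0.
move=> z /andP[z0 zm].
have {}zm : z < m by lra.
have zz : `|z| = z by rewrite ger0_norm.
have := zm; rewrite !lt_min => /andP[/andP[zd zd1] zr].
have := gd z; rewrite /ball /= sub0r normrN zz => /(_ zd1).
rewrite g0 sub0r normrN lt_min => /andP[geps grho].
exists (y + z *: (nu.2, - nu.1) + g z *: nu).
  have := P z (g z); rewrite zz => /(_ zd geps)[[_ Fq] _ _].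
  split; first exact: Fq.
  rewrite /sqdist /= /GRing.scale /=.
  have -> : (y.1 + z * nu.2 + g z * nu.1 - y.1) ^+ 2 + (y.2 + z * - nu.1 + g z * nu.2 - y.2) ^+ 2
    = (z ^+ 2 + g z ^+ 2) * (nu.1 ^+ 2 + nu.2 ^+ 2) by ring.
  rewrite nn mulr1 -(real_normK (num_real (g z))).
  have ng := normr_ge0 (g z).
  nra.
rewrite /= /GRing.scale /=.
have -> : (y.1 + z * nu.2 + g z * nu.1 - y.1) * nu.2 + (y.2 + z * - nu.1 + g z * nu.2 - y.2) * - nu.1
  = z * (nu.1 ^+ 2 + nu.2 ^+ 2) by ring.
by rewrite nn mulr1.
Qed.

End Projection.

(** * Stable solutions *)

Section StabilityFlatness.
Variable R : realType.
Variable U : R * R -> R.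
Hypothesis stableU : stability_inequality U.
Hypothesis smoothF : smooth_free_boundary U.
Hypothesis closedF : closed (free_boundary U).
Hypothesis curv_ge0 : forall x, free_boundary U x -> 0 <= curvature U x.
Hypothesis curv_lsc : forall y h, free_boundary U y -> h < curvature U y ->
  exists2 rho : R, 0 < rho & forall x, free_boundary U x ->
    sqdist y x <= rho ^+ 2 -> h <= curvature U x.

Lemma log_cutoff_ge (y x : R * R) (ep : R) : 0 <= ep <= 1 / 2 ->
  sqdist y x <= 1 -> expR (- 2) <= log_cutoff y ep x.
Proof.
move=> /andP[ep0 ep1] S; apply: flat0_ge.
have S0 := sqdist_ge0 y x.
have l1 : ln (1 + sqdist y x) <= 1.
  rewrite -ler_expR lnK ?posrE ?ltr_pwDl//.
  by apply: le_trans (expR_ge1Dx 1); lra.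
have : ep * ln (1 + sqdist y x) <= 1 / 2 * 1.
  apply: ler_pM => //; apply: ln_ge0; lra.
lra.
Qed.

(** Logarithmic cutoffs have arbitrarily small Dirichlet energy in the plane,
    so the nonnegative curvature has no mass on the free boundary. *)
Lemma stable_curvature_eq0 y : free_boundary U y -> curvature U y = 0.
Proof.
move=> Fy; apply/eqP/negPn/negP => nz.
have h0 : 0 < curvature U y by rewrite lt_neqAle eq_sym nz curv_ge0.
set h := curvature U y in h0.
have h2 : h / 2 < curvature U y by rewrite -/h; lra.
have [rho0 rho00 lsc] := curv_lsc Fy h2.
pose rho := Num.min rho0 1.
have rhop : 0 < rho by rewrite lt_min rho00 ltr01.
have rho1 : rho ^+ 2 <= 1 by rewrite exprn_ile1 ?ge_min ?lexx ?orbT// ltW.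
have rho2 : rho ^+ 2 <= rho0 ^+ 2.
  by rewrite ler_sqr ?nnegrE; [rewrite ge_min lexx|exact: ltW|exact: ltW].
pose A := free_boundary U `&` [set x | sqdist y x <= rho ^+ 2].
have mA : measurable (A : set (caratheodory_type (hausdorff1_outer R))).
  apply: closed_caratheodory; apply: closedI => //.
  rewrite (_ : [set x | _] = sqdist y @^-1` [set t | t <= rho ^+ 2])//.
  by apply: closed_comp => [z _|]; [exact: sqdist_continuous|exact: closed_le].
have [tau [l [tau1 l0 proj]]] := graph_projection rhop smoothF Fy.
have HA := hausdorff1_projection tau1 l0 proj.
pose c : R := h / 2 * expR (- 2) ^+ 2.
have c0 : 0 < c by rewrite mulr_gt0 ?divr_gt0 ?exprn_gt0 ?expR_gt0.
pose K := c * (l / 2).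
have K0 : 0 < K by rewrite mulr_gt0 ?divr_gt0.
have key N (ep : R) : 0 < ep <= 1 / 2 -> expR (ep^-1) = 4 ^+ N ->
    K <= 256 * ep ^+ 2 * N.+1%:R.
  move=> /andP[ep0 ep1] epN; rewrite -lee_fin.
  have := stableU (log_cutoff_test y ep0).
  move=> /le_trans /(_ (log_cutoff_energy y (positive_phase U) ep0 epN)).
  apply: le_trans.
  apply: le_trans (_ : _ <= \int[hausdorff1_measure R]_(x in A) (cst c%:E x))%E _.
    rewrite integral_cst// /K EFinM.
    by apply: lee_pmul => //; rewrite lee_fin ?ltW// divr_gt0.
  apply: ge0_le_integral_sup => [x _|x Fx|x].
  - by rewrite lee_fin ltW.
  - by rewrite lee_fin mulr_ge0 ?sqr_ge0// curv_ge0.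
  rewrite !patchE; case: ifPn => [|_].
    rewrite inE => -[Fx xr]; rewrite ifT ?inE// lee_fin /c.
    apply: ler_pM.
    + by rewrite divr_ge0// ltW.
    + by rewrite sqr_ge0.
    + by apply: lsc => //; exact: le_trans xr rho2.
    + rewrite ler_sqr ?nnegrE ?expR_ge0 ?flat_ge0//.
      apply: log_cutoff_ge; first by rewrite ltW.
      exact: le_trans xr rho1.
  case: ifPn => [|//]; rewrite inE => Fx.
  by rewrite lee_fin mulr_ge0 ?sqr_ge0// curv_ge0.
pose c4 : R := ln 4.
have c40 : 0 < c4 by rewrite ln_gt0// ltr1n.
(* [N > 2 / c4] makes [ep <= 1 / 2], so that the cutoff is bounded below on the
   unit disk, and [N > 512 / (c4 ^ 2 * K)] makes the energy smaller than [K]. *)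
pose M := Num.max (2 / c4) (512 / (c4 ^+ 2 * K)).
pose N := (Num.truncn M).+1.
have MN : M < N%:R := truncnS_gt M.
have := MN; rewrite gt_max => /andP[N2 N5].
have N0 : 0 < N%:R :> R by rewrite ltr0n.
have ep0 : 0 < (N%:R * c4)^-1 by rewrite invr_gt0 mulr_gt0.
have := key N (N%:R * c4)^-1.
rewrite ep0 invrK expRM_natl lnK ?posrE ?ltr0n//.
have -> : (N%:R * c4)^-1 <= 1 / 2.
  rewrite mul1r lef_pV2 ?posrE ?mulr_gt0//.
  by move: N2; rewrite ltr_pdivrMr// => /ltW.
move=> /(_ isT erefl); apply/negP; rewrite -ltNge.
apply: le_lt_trans (_ : _ <= 512 / (N%:R * c4 ^+ 2)) _.
  have N1 : N.+1%:R <= 2 * N%:R :> R.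
    have : 1 <= N%:R :> R by rewrite ler1n.
    by rewrite -natr1; lra.
  apply: le_trans (ler_wpM2l _ N1) _; first by rewrite mulr_ge0// sqr_ge0.
  rewrite le_eqVlt; apply/orP; left; apply/eqP; field.
  by rewrite !gt_eqF.
rewrite ltr_pdivrMr ?mulr_gt0 ?exprn_gt0//.
move: N5; rewrite ltr_pdivrMr ?mulr_gt0 ?exprn_gt0// => N5.
by apply: lt_le_trans N5 _; rewrite le_eqVlt; apply/orP; left; apply/eqP; ring.
Qed.

End StabilityFlatness.

Theorem theorem3p1 (R : realType) (U : R * R -> R)
  (stableU : stable_classical_solution U)
  (FU : free_boundary U !=set0) :
  exists2 T : R * R -> R * R, rigid_motion T &
    (forall x, U (T x) = pos_part x.2) \/
    (exists2 a : R, 0 < a &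
      forall x, U (T x) = pos_part x.2 + neg_part (x.2 + a)).
Proof.
have [solU stab] := stableU.
have [p [q [r [s [a [b [J bdry curvE]]]]]]] := solution_jet solU.
have U0 := solution_ge0 solU.
have sF := solution_free_boundary solU.
have FP := free_boundaryP solU.
have inn y : free_boundary U y -> exists2 m : R * R, 0 < m.1 ^+ 2 + m.2 ^+ 2 &
    forall v, 0 < v.1 * m.1 + v.2 * m.2 -> inward (positive_phase U) y v.
  move=> Fy; have [m m0 mP] := graph_sides sF Fy; exists m => // v.
  exact: (mP v).1.
have H0 y : free_boundary U y -> 0 <= curvature U y.
  move=> Fy; have /FP[cy nDy] := Fy; have [m m0 mP] := inn y Fy.
  rewrite curvE// oppr_ge0.
  exact: (normal_second_derivative_le0 J U0 bdry cy nDy m0 mP).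
have cF : closed (free_boundary U).
  rewrite (_ : free_boundary U = closure (positive_phase U) `&` ~` positive_phase U).
    apply: closedI; first exact: closed_closure.
    exact/open_closedC/(jet_open J).
  by apply/seteqP; split => x /FP.
have lsc y h : free_boundary U y -> h < curvature U y ->
  exists2 rho : R, 0 < rho & forall x, free_boundary U x ->
    sqdist y x <= rho ^+ 2 -> h <= curvature U x.
  move=> Fy hy; have /FP[cy nDy] := Fy.
  pose k x := - (p x * (p x * r x + q x * s x) + q x * (p x * s x - q x * r x)).
  have kc : {within closure (positive_phase U), continuous k}.
    move=> x; apply: cvgN; apply: cvgD; apply: cvgM;
      by [exact: jet_cp J x|exact: jet_cq J x|exact: within_b1 J x|exact: within_b2 J x].
  have kE x : free_boundary U x -> curvature U x = k x.
    by move=> /FP[cx nDx]; rewrite curvE.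
  move: hy; rewrite kE// => hy.
  have := (subspace_continuousP _ _).1 kc y cy.
  move=> /cvgr_gt /(_ _ hy); rewrite near_withinE => /near_square[d d0 dP].
  exists (d / 2); first by rewrite divr_gt0.
  move=> x Fx xd; have d20 : 0 <= d / 2 by rewrite divr_ge0// ltW.
  have [x1 x2] := sqdist_coord d20 xd.
  rewrite kE//; apply/ltW/dP; [lra|lra|by have /FP[] := Fx].
have curv0 := stable_curvature_eq0 stab sF cF H0 lsc.
have [y Fy] := FU; have /FP[cy nDy] := Fy.
have N1 : forall x, positive_phase U x -> p x ^+ 2 + q x ^+ 2 = 1.
  apply: (gradient_eq1 J U0 bdry cy nDy) => z cz nDz.
  have Fz : free_boundary U z by apply/FP.
  have [m m0 mP] := inn z Fz.
  apply: (normal_second_derivative_eq0 J U0 bdry cz nDz m0 mP).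
  by have := curv0 z Fz; rewrite curvE// => /eqP; rewrite oppr_eq0 => /eqP.
have rs0 x : positive_phase U x -> r x = 0 /\ s x = 0.
  move=> Dx; have Nx := N1 x Dx.
  have Hv w := inward_N_le0 J U0 bdry (v := w) Nx (open_inward w (jet_open J) Dx).
  have b1 : p x * r x + q x * s x = 0.
    by have := Hv (1, 0); have := Hv (-1, 0); rewrite /=; lra.
  have b2 : p x * s x - q x * r x = 0.
    by have := Hv (0, 1); have := Hv (0, -1); rewrite /=; lra.
  split; rewrite -[LHS]mul1r -Nx.
    have -> : (p x ^+ 2 + q x ^+ 2) * r x =
      p x * (p x * r x + q x * s x) - q x * (p x * s x - q x * r x) by ring.
    by rewrite b1 b2 !mulr0 subr0.
  have -> : (p x ^+ 2 + q x ^+ 2) * s x =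
    q x * (p x * r x + q x * s x) + p x * (p x * s x - q x * r x) by ring.
  by rewrite b1 b2 !mulr0 addr0.
have [x0 [Dx0 _]] : positive_phase U `&` setT !=set0 by apply: cy; exact: filterT.
apply: (one_or_two_planes J (solution_continuous solU) _ _ rs0 N1 Dx0).
- by [].
- exact: (solution_zero solU).
- have [m m0 mP] := graph_sides sF Fy; exists y, m; split => // v.
  exact: (mP v).2.
Qed.
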